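(* Let $\rho>0$, let $U_f:=\mathrm{span}_{\mathbb{R}^{n_a}}(\{\phi_j\}_{j\in[m]})$ be a finite-dimensional space of $\mathbb{R}^n$-valued functions on $I$ with coefficients $a_j\in\mathbb{R}^{n_a}$ (either real-valued coefficients with vector-valued basis functions, or vector-valued coefficients with real-valued basis functions, as specified in the context), with $\dim(U_f)=n_a\cdot m$ and associated matrix $\Sigma$. For $f_a=\sum_{j=1}^m a_j\phi_j\in U_f$, let $\tilde a=M(a):=a+\frac{1}{\sqrt{2\rho}}\Sigma^{1/2}Z$, where $Z$ is a standard Gaussian random vector in $\mathbb{R}^{\dim(U_f)}$. Then $M$ is $\rho$-CGP (with respect to the metric $(a,a')\mapsto\mathrm{dist}_2(f_a,f_{a'})$), and for every $f_a\in U_f$: 1. $\mathbb{E}[\mathrm{dist}_2(f_{\tilde a},f_a)]=\sqrt{2}\,\frac{\Gamma(\dim(U_f)/2+1/2)}{\Gamma(\dim(U_f)/2)\sqrt{2\rho}}\le\frac{\sqrt{\dim(U_f)}}{\sqrt{2\rho}}$; 2. for every $\beta\in(0,1)$, with probability at least $1-\beta$, $\mathrm{dist}_2(f_{\tilde a},f_a)\le\frac{\eta(\beta;\dim(U_f),2)}{\sqrt{2\rho}}$, where $\eta(\beta;k,2):=\sqrt{k+2\sqrt{k\ln(1/\beta)}+2\ln(1/\beta)}$.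
   Context: $I=I_1\times\cdots\times I_d$ with each $I_i\subseteq\mathbb{R}$ (measurable). For square-integrable $f,g:I\to\mathbb{R}^n$ (identified when equal almost everywhere), $\mathrm{dist}_2(f,g):=\left(\int_I\|f(t)-g(t)\|^2\,dt\right)^{1/2}$, with $\|\cdot\|$ the Euclidean norm. $[m]=\{1,\dots,m\}$; $\Gamma$ is the gamma function. The basis functions $\phi_1,\dots,\phi_m$ are square-integrable and linearly independent. The two settings are: (i) Real-valued coefficients ($n_a=1$), basis functions $\phi_j=(\phi_{j,1},\dots,\phi_{j,n}):I\to\mathbb{R}^n$. Here $a=(a_1,\dots,a_m)\in\mathbb{R}^m$, and $\Sigma$ is the inverse of the $m\times m$ matrix $\Sigma^{-1}$ with $[\Sigma^{-1}]_{j,l}=\sum_{r=1}^n\int_I\phi_{j,r}(t)\phi_{l,r}(t)\,dt$. (The case $n=1$ is that of real-valued functions.) (ii) Vector-valued coefficients ($n_a=n$), basis functions $\phi_j:I\to\mathbb{R}$. Here $a_j=(a_{j,1},\dots,a_{j,n})^{\mathsf T}\in\mathbb{R}^n$, the coefficient vector is ordered as $a=(a_{1,1},\dots,a_{m,1},\dots,a_{1,n},\dots,a_{m,n})^{\mathsf T}\in\mathbb{R}^{mn}$, and $\Sigma$ is the inverse of the $mn\times mn$ block-diagonal matrix $\Sigma^{-1}$ whose $n$ diagonal blocks all equal the $m\times m$ matrix $\Sigma_0^{-1}$ with $[\Sigma_0^{-1}]_{j,l}=\int_I\phi_j(t)\phi_l(t)\,dt$. $\Sigma^{1/2}$ is the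 symmetric positive definite square root of $\Sigma$. For distributions $\mathcal{P},\mathcal{Q}$ with densities $p,q$ and $\alpha>1$, the Rényi divergence of order $\alpha$ is $D_\alpha(\mathcal{P}\|\mathcal{Q}):=\frac{1}{\alpha-1}\log\left(\int p(y)^\alpha q(y)^{1-\alpha}\,dy\right)$. A randomized mechanism $M:U\to V$ on a metric space $(U,\mathrm{dist})$, with $\mathcal{M}(x)$ denoting the distribution of $M(x)$, satisfies $\rho$-CGP (concentrated geo-privacy) if for all $x,x'\in U$ and all $\alpha>1$, $D_\alpha(\mathcal{M}(x)\|\mathcal{M}(x'))\le\alpha\rho\,\mathrm{dist}(x,x')^2$. *)

(* Defs.v *)
From HB Require Import structures.
From mathcomp Require Import all_boot all_order all_algebra.
From mathcomp Require Import all_classical all_reals all_analysis.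
From mathcomp Require Import measurable_realfun.

Set Implicit Arguments.
Unset Strict Implicit.
Unset Printing Implicit Defensive.

Import Order.TTheory GRing.Theory Num.Theory.
Import numFieldNormedType.Exports.

Local Open Scope classical_set_scope.
Local Open Scope ring_scope.

(* R^n is 'cV[R]_n, with the sigma-algebra generated by the coordinates (the
   Borel one). Its library norm `|v| is the sup norm, hence enorm below. *)
Definition cV_display : measure_display.
Proof. exact: default_measure_display. Qed.

Section cV_measurable.
Context {R : realType} {n : nat}.

Definition cV_cylinder : set (set 'cV[R]_n) :=
  [set B | exists i : 'I_n, exists2 A : set R, measurable A &
    B = [set v : 'cV[R]_n | A (v i 0)]].

Let cV_set0 : <<s cV_cylinder >> set0.
Proof. exact: sigma_algebra0. Qed.

Let cV_setC A : <<s cV_cylinder >> A -> <<s cV_cylinder >> (~` A).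
Proof. exact: sigma_algebraC. Qed.

Let cV_bigcup (F : (set 'cV[R]_n)^nat) :
  (forall i, <<s cV_cylinder >> (F i)) -> <<s cV_cylinder >> (\bigcup_i F i).
Proof. exact: sigma_algebra_bigcup. Qed.

HB.instance Definition _ := @isMeasurable.Build cV_display 'cV[R]_n
  <<s cV_cylinder >> cV_set0 cV_setC cV_bigcup.

Lemma measurable_coord (i : 'I_n) :
  measurable_fun [set: 'cV[R]_n] (fun v : 'cV[R]_n => v i 0).
Proof.
move=> _ A mA; rewrite setTI; apply: sub_sigma_algebra.
by exists i; exists A.
Qed.

Lemma measurable_cVP d (T : measurableType d) (f : T -> 'cV[R]_n) :
  (forall i, measurable_fun [set: T] (fun x => f x i 0)) ->
  measurable_fun [set: T] f.
Proof.
move=> mf; apply: (@measurability _ _ _ _ _ _ cV_cylinder) => //.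
move=> _ [_ [i [A mA ->]] <-].
exact: (mf i measurableT A mA).
Qed.

End cV_measurable.

Section lebesgue_cV.
Context {R : realType}.

Definition cV_cons n (p : R * 'cV[R]_n) : 'cV[R]_n.+1 :=
  \col_i if unlift ord0 i is Some j then p.2 j 0 else p.1.

Lemma cV_cons0 n (p : R * 'cV[R]_n) : cV_cons p ord0 0 = p.1.
Proof. by rewrite mxE unlift_none. Qed.

Lemma cV_consS n (p : R * 'cV[R]_n) i : cV_cons p (lift ord0 i) 0 = p.2 i 0.
Proof. by rewrite mxE liftK. Qed.

Lemma measurable_cV_cons n : measurable_fun setT (@cV_cons n).
Proof.
apply: measurable_cVP => i.
case: (unliftP ord0 i) => [j|] ->.
  under eq_fun do rewrite cV_consS.
  exact: (measurableT_comp (measurable_coord j) measurable_snd).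
under eq_fun do rewrite cV_cons0.
exact: measurable_fst.
Qed.

Definition cV_uncons n (v : 'cV[R]_n.+1) : R * 'cV[R]_n :=
  (v ord0 0, \col_i v (lift ord0 i) 0).

Lemma measurable_cV_uncons n : measurable_fun setT (@cV_uncons n).
Proof.
apply: measurable_fun_pair; first exact: measurable_coord.
apply: measurable_cVP => i; under eq_fun do rewrite mxE.
exact: measurable_coord.
Qed.

Lemma cV_consK n : cancel (@cV_cons n) (@cV_uncons n).
Proof.
move=> p; rewrite /cV_uncons cV_cons0 [RHS]surjective_pairing; congr pair.
by apply/colP => i; rewrite mxE cV_consS.
Qed.

Section step.
Variables (n : nat) (mu : {sigma_finite_measure set 'cV[R]_n -> \bar R}).

Definition lebesgue_cV_step : set 'cV[R]_n.+1 -> \bar R :=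
  pushforward ((@lebesgue_measure R) \x mu)%E (@cV_cons n).

HB.instance Definition _ := Measure.copy lebesgue_cV_step
  (measure_function_pushforward__canonical__measure_function_Measure
     ((@lebesgue_measure R) \x mu)%E (@measurable_cV_cons n)).

Let sigma_finite_step : sigma_finite setT lebesgue_cV_step.
Proof.
have /sigma_finiteP[F [TF ndF Foo]] := sigma_finiteT (@lebesgue_measure R).
have /sigma_finiteP[G [TG ndG Goo]] := sigma_finiteT mu.
exists (fun k => @cV_uncons n @^-1` (F k `*` G k)).
  rewrite -preimage_bigcup -[LHS](@preimage_setT _ _ (@cV_uncons n)).
  congr (_ @^-1` _); apply/esym/seteqP; split=> // -[x y] _ /=.
  have [i _ Fx] : (\bigcup_i F i) x by rewrite -TF.
  have [j _ Gy] : (\bigcup_i G i) y by rewrite -TG.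
  exists (maxn i j) => //; split => /=.
    by move: Fx; exact/subsetPset/ndF/leq_maxl.
  by move: Gy; exact/subsetPset/ndG/leq_maxr.
move=> k; have [mF Fk] := Foo k; have [mG Gk] := Goo k; split.
  rewrite -[X in measurable X]setTI.
  by apply: measurable_cV_uncons => //; exact: measurableX.
rewrite /lebesgue_cV_step /pushforward -comp_preimage.
rewrite (_ : _ \o _ = id); last by apply/funext; exact: cV_consK.
by rewrite preimage_id product_measure1E// lte_mul_pinfty// ge0_fin_numE.
Qed.

HB.instance Definition _ := Measure_isSigmaFinite.Build _ _ _
  lebesgue_cV_step sigma_finite_step.

End step.

(* Lebesgue measure on R^n: unit mass at the point of R^0, then iterated
   products with the one-dimensional Lebesgue measure. *)
Fixpoint lebesgue_cV n : {sigma_finite_measure set 'cV[R]_n -> \bar R} :=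
  if n is n'.+1 then lebesgue_cV_step (lebesgue_cV n') else dirac (0 : 'cV[R]_0).

Definition box d (J : 'I_d -> set R) : set 'cV[R]_d :=
  [set t | forall i, J i (t i 0)].

Lemma lebesgue_cV_box n (A : 'I_n -> set R) : (forall i, measurable (A i)) ->
  lebesgue_cV n (box A) = (\prod_(i < n) lebesgue_measure (A i))%E.
Proof.
elim: n A => [|n IH] A mA.
  by rewrite big_ord0 /= diracE mem_set// => -[].
rewrite big_ord_recl -IH => [|i]; last exact: mA.
rewrite /= /lebesgue_cV_step /pushforward.
have mbox : measurable (box (fun i => A (lift ord0 i))).
  rewrite (_ : box _ = \big[setI/setT]_(i < n)
      ((fun v : 'cV[R]_n => v i 0) @^-1` A (lift ord0 i))).
    apply: bigsetI_measurable => i _; rewrite -[X in measurable X]setTI.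
    exact: measurable_coord.
  rewrite -bigcap_seq; apply/seteqP; split=> v /= Av i.
    by move=> _; exact: Av.
  by apply: Av; exact: mem_index_enum.
rewrite -product_measure1E//; last exact: mA.
rewrite (_ : _ @^-1` _ = A ord0 `*` box (fun i => A (lift ord0 i)))//.
apply/seteqP; split=> p /=.
  move=> Ap; split; first by have := Ap ord0; rewrite cV_cons0.
  by move=> i; have := Ap (lift ord0 i); rewrite cV_consS.
move=> [A0 Ap] i; case: (unliftP ord0 i) => [j|] ->.
  by rewrite cV_consS; exact: Ap.
by rewrite cV_cons0.
Qed.

End lebesgue_cV.

Section euclidean_l2.
Context {R : realType}.

Definition enorm n (v : 'cV[R]_n) : R := Num.sqrt (\sum_i v i 0 ^+ 2).

Context {d : nat} (I : set 'cV[R]_d).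

Definition sq_integrable (f : 'cV[R]_d -> R) :=
  measurable_fun I f /\ (\int[lebesgue_cV d]_(t in I) (f t ^+ 2)%:E < +oo)%E.

Definition sq_integrable_vec n (f : 'cV[R]_d -> 'cV[R]_n) :=
  measurable_fun I f /\
  (\int[lebesgue_cV d]_(t in I) (enorm (f t) ^+ 2)%:E < +oo)%E.

Definition dist2 n (f g : 'cV[R]_d -> 'cV[R]_n) : R :=
  Num.sqrt (\int[lebesgue_cV d]_(t in I) (enorm (f t - g t) ^+ 2)).

(* Linear independence of functions identified when equal almost everywhere. *)
Definition lin_indep (V : lmodType R) m (phi : 'I_m -> 'cV[R]_d -> V) :=
  forall a : 'I_m -> R,
    {ae lebesgue_cV d, forall t, I t -> \sum_j a j *: phi j t = 0} ->
    forall j, a j = 0.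

Definition real_comb n m (phi : 'I_m -> 'cV[R]_d -> 'cV[R]_n) (a : 'cV[R]_m)
  : 'cV[R]_d -> 'cV[R]_n := fun t => \sum_j a j 0 *: phi j t.

Definition real_gram n m (phi : 'I_m -> 'cV[R]_d -> 'cV[R]_n) : 'M[R]_m :=
  \matrix_(j, l)
    \sum_r (\int[lebesgue_cV d]_(t in I) (phi j t r 0 * phi l t r 0)).

(* The coefficient vector (a_11, ..., a_m1, ..., a_1n, ..., a_mn) is made of n
   blocks of size m: a_jr is entry j of block r. *)
Definition vec_coef n m (a : 'cV[R]_(\sum_(r < n) m)) (j : 'I_m) : 'cV[R]_n :=
  \col_r submxcol a r j 0.

Definition vec_comb n m (phi : 'I_m -> 'cV[R]_d -> R)
    (a : 'cV[R]_(\sum_(r < n) m)) : 'cV[R]_d -> 'cV[R]_n :=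
  fun t => \sum_j phi j t *: vec_coef a j.

Definition vec_gram0 m (phi : 'I_m -> 'cV[R]_d -> R) : 'M[R]_m :=
  \matrix_(j, l) \int[lebesgue_cV d]_(t in I) (phi j t * phi l t).

Definition vec_gram n m (phi : 'I_m -> 'cV[R]_d -> R)
  : 'M[R]_(\sum_(r < n) m) := \mxdiag_(r < n) vec_gram0 phi.

(* function_space n m na f Sigma: a |-> f a parametrizes the span of m linearly
   independent square-integrable basis functions on I with coefficients in
   R^na, its values lie in R^n, and Sigma is the associated matrix.
   The number N of real coordinates of a is na * m. *)
Variant function_space (n m : nat) : nat ->
    forall N, ('cV[R]_N -> 'cV[R]_d -> 'cV[R]_n) -> 'M[R]_N -> Prop :=
| RealCoef (phi : 'I_m -> 'cV[R]_d -> 'cV[R]_n) :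
    (forall j, sq_integrable_vec (phi j)) -> lin_indep phi ->
    @function_space n m 1 m (real_comb phi) (invmx (real_gram phi))
| VecCoef (phi : 'I_m -> 'cV[R]_d -> R) :
    (forall j, sq_integrable (phi j)) ->
    @lin_indep R^o m phi ->
    @function_space n m n (\sum_(r < n) m) (vec_comb (n := n) phi) (invmx (vec_gram n phi)).

End euclidean_l2.

Section gaussian_mechanism.
Context {R : realType}.

Definition spd N (S : 'M[R]_N) :=
  S^T = S /\ forall v : 'cV[R]_N, v != 0 -> 0 < (v^T *m S *m v) 0 0.

Definition spd_sqrt N (A : 'M[R]_N) : 'M[R]_N :=
  xget 0 [set S | spd S /\ S *m S = A].

Context {disp : measure_display} {Omega : measurableType disp}
  {P : probability Omega R}.

(* The coordinates of Z are i.i.d. standard normal. *)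
Definition std_gaussian N (Z : {RV P >-> 'cV[R]_N}) :=
  forall A : 'I_N -> set R, (forall i, measurable (A i)) ->
    distribution P Z (box A) = (\prod_(i < N) normal_prob 0 1 (A i))%E.

Section mechanism.
Variables (N : nat) (rho : R) (Sigma : 'M[R]_N) (Z : {RV P >-> 'cV[R]_N}).
Variable a : 'cV[R]_N.

Definition gauss_mech : Omega -> 'cV[R]_N :=
  fun w => a + (Num.sqrt (2 * rho))^-1 *: (spd_sqrt Sigma *m Z w).

Let measurable_gauss_mech : measurable_fun setT gauss_mech.
Proof.
apply: measurable_cVP => i.
under eq_fun do rewrite /gauss_mech !mxE.
apply: measurable_funD; first exact: measurable_cst.
apply: measurable_funM; first exact: measurable_cst.
apply: measurable_sum => j.
apply: measurable_funM; first exact: measurable_cst.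
apply: (measurableT_comp (measurable_coord j)).
exact: measurable_funPT.
Qed.

HB.instance Definition _ :=
  isMeasurableFun.Build _ _ _ _ gauss_mech measurable_gauss_mech.

End mechanism.

End gaussian_mechanism.

Section privacy.
Context {R : realType} {N : nat}.
Implicit Types (p q : 'cV[R]_N -> R).

Definition has_density (nu : probability 'cV[R]_N R) p :=
  [/\ measurable_fun setT p, forall y, 0 <= p y &
    forall A, measurable A -> nu A = (\int[lebesgue_cV N]_(y in A) (p y)%:E)%E].

(* u^alpha * v^(1 - alpha), with the usual conventions at v = 0 since alpha > 1
   (whereas the library has 0 `^ r = 0 for r < 0). *)
Definition renyi_kernel (alpha u v : R) : \bar R :=
  if v == 0 then (if u == 0 then 0%E else +oo%E)
  else (u `^ alpha * v `^ (1 - alpha))%:E.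

Definition renyi_div (alpha : R) p q : \bar R :=
  ((alpha - 1)^-1%:E *
   lne (\int[lebesgue_cV N]_y renyi_kernel alpha (p y) (q y)))%E.

(* The divergence is required to be defined, i.e. the laws have densities; the
   bound is asserted for every choice of these densities. *)
Definition CGP (U : Type) (dist : U -> U -> R) (rho : R)
    (law : U -> probability 'cV[R]_N R) :=
  (forall x, exists p, has_density (law x) p) /\
  forall (x x' : U) (p q : 'cV[R]_N -> R) (alpha : R),
    has_density (law x) p -> has_density (law x') q -> 1 < alpha ->
    (renyi_div alpha p q <= (alpha * rho * dist x x' ^+ 2)%:E)%E.

End privacy.

Definition Gamma {R : realType} (x : R) : R :=
  \int[@lebesgue_measure R]_(t in `]0, +oo[) (t `^ (x - 1) * expR (- t)).

Definition eta2 {R : realType} (beta : R) (k : nat) : R :=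
  Num.sqrt (k%:R + 2 * Num.sqrt (k%:R * ln (1 / beta)) + 2 * ln (1 / beta)).

(* Main.v *)
(* If G is the Gram matrix of the basis, then dist2 (f a) (f b) ^ 2 is the
   quadratic form Q(a - b) of G, and G is positive definite because the basis is
   linearly independent modulo almost everywhere equality. As Sigma = G^-1,
   the noise Sigma^(1/2) Z / sqrt (2 rho) has density proportional to
   exp (- rho Q), and its distance error is exactly |Z| / sqrt (2 rho).

   Privacy is then an exact computation of the Renyi divergence, by completing
   the square. The error bounds are facts about |Z|: radial integration
   identifies, up to a common constant, the total mass and the mean of |Z| with
   the integrals defining Gamma (k / 2) and Gamma (k / 2 + 1 / 2);
   E |Z| <= sqrt k follows from E |Z| ^ 2 <= k; and the tail bound is Chernoff's
   inequality for the chi-squared law. *)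
Require Import Defs.
From HB Require Import structures.
From mathcomp Require Import all_boot all_order all_algebra.
From mathcomp Require Import all_classical all_reals all_analysis.
From mathcomp Require Import measurable_realfun.
From mathcomp Require Import ring lra.
From mathcomp Require complex.

Set Implicit Arguments.
Unset Strict Implicit.
Unset Printing Implicit Defensive.

Import Order.TTheory GRing.Theory Num.Theory.
Import numFieldNormedType.Exports.

Local Open Scope classical_set_scope.
Local Open Scope ring_scope.

(** Three features of the definitions shape the proof. [Gamma] is a real-valued integral, equal to 0
    when the integral is infinite, so the quotient of Gamma values is meaningful only once both
    integrals are known to be finite and the denominator non-zero. No estimate of them is made:
    total mass 1 forces this for Gamma (k / 2), and the inequality E |Z| <= sqrt k, proved before
    the exact mean, makes the integral for Gamma (k / 2 + 1 / 2) finite. [CGP] quantifies over all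
    densities of the laws, so the computation with the explicit exponential is transferred by almost
    everywhere uniqueness. Finally, the density of the noise requires a linear change of variables,
    but the noise map is symmetric positive definite; this restricted case admits an induction on
    Schur complements. *)

(** * Square roots of positive definite matrices *)

Lemma poly_interpolation (F : fieldType) (g : F -> F) (s : seq F) :
  exists p : {poly F}, {in s, forall x, p.[x] = g x}.
Proof.
elim: s => [|a s [p ps]]; first by exists 0.
have [as_|as_] := boolP (a \in s).
  by exists p => x; rewrite inE => /predU1P[->|]; exact: ps.
pose q := \prod_(b <- s) ('X - b%:P).
have qa : q.[a] != 0 by rewrite -rootE root_prod_XsubC.
(* Newton's correction: [q] vanishes on [s], so the values already matched are kept. *)
exists (p + ((g a - p.[a]) / q.[a]) *: q) => x; rewrite !hornerE.
rewrite inE => /predU1P[->|xs]; first by rewrite divfK// addrC subrK.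
suff -> : q.[x] = 0 by rewrite mulr0 addr0 ps.
by apply/eqP; rewrite -rootE root_prod_XsubC.
Qed.

Lemma tr_mul_gt0 (R : realDomainType) n (v : 'cV[R]_n) :
  v != 0 -> 0 < (v^T *m v) 0 0.
Proof.
move=> v0; have sq i : true -> 0 <= v^T 0 i * v i 0.
  by rewrite mxE -expr2 sqr_ge0.
rewrite mxE lt_neqAle sumr_ge0 ?andbT// eq_sym psumr_neq0//.
have [j vj0] : exists j, v j 0 != 0.
  apply/existsP; apply: contraR v0; rewrite negb_exists => /forallP v0.
  by apply/eqP/colP => j; rewrite mxE; apply/eqP; rewrite -[_ == _]negbK.
by apply/hasP; exists j; rewrite ?mem_index_enum//= mxE -expr2 exprn_even_gt0.
Qed.

Lemma tr_horner_mx (R : comNzRingType) n (A : 'M[R]_n.+1) (p : {poly R}) :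
  (horner_mx A p)^T = horner_mx A^T p.
Proof.
elim/poly_ind: p => [|p c IH]; first by rewrite !rmorph0 trmx0.
rewrite !rmorphD !rmorphM /= !horner_mx_X !horner_mx_C linearD /= trmx_mul IH.
by rewrite tr_scalar_mx; congr (_ + _); exact/comm_mx_horner.
Qed.

Section spd_sqrt_existence.
Import complex.
Variable (R : rcfType).
Local Notation C := R[i]%C.
Local Notation toC := (real_complex R).

(** Over the complex numbers [A] is Hermitian, hence normal, and the spectral theorem applies with
    real eigenvalues. [P] may stay complex: the root of [A] is built as a real polynomial in [A],
    and the diagonal form serves to check its fourth power. *)
Lemma real_sym_diag n (A : 'M[R]_n.+1) : A^T = A ->
  exists (P : 'M[C]_n.+1) (d : 'rV[R]_n.+1), P \in unitmx /\
   map_mx toC A = invmx P *m diag_mx (map_mx toC d) *m P.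
Proof.
move=> As.
have AH : map_mx toC A \is hermsymmx.
  apply: realsym_hermsym.
    by apply/is_hermitianmxP; rewrite expr0 scale1r map_mx_id// map_trmx As.
  by apply/mxOverP => i j; rewrite mxE; apply/complex_realP; exists (A i j).
have := hermitian_normalmx AH; move/orthomx_spectralP => E.
set P := spectralmx _ in E; set D := spectral_diag _ in E.
have Dr : D \is a mxOver Num.real by exact: hermitian_spectral_diag_real.
exists P, (\row_i Re (D 0 i)); split; first exact: spectral_unit.
rewrite {1}E; congr (_ *m diag_mx _ *m _); apply/rowP => i; rewrite !mxE.
by have /mxOverP/(_ 0 i)/RRe_real := Dr.
Qed.

(* A real polynomial p with p(x) = x^(1/4) on the spectrum gives T = p(A)
   symmetric with T^4 = A; taking a fourth root makes the square root T^2 of A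
   positive definite for free. *)
Lemma spd_sqrt_exists n (A : 'M[R]_n) : A^T = A ->
    (forall v : 'cV[R]_n, v != 0 -> 0 < (v^T *m A *m v) 0 0) ->
  exists S : 'M[R]_n, [/\ S^T = S,
    forall v : 'cV[R]_n, v != 0 -> 0 < (v^T *m S *m v) 0 0 & S *m S = A].
Proof.
case: n A => [|n] A As Apos.
  by exists A; split => //; apply/matrixP => -[].
have [P [d [Pu EA]]] := real_sym_diag As.
have d0 i : 0 < d 0 i.
  have : eigenvalue (map_mx toC A) (toC (d 0 i)).
    apply/eigenvalueP; exists (row i P); last first.
      apply: contraTneq Pu => Pi0; rewrite unitmxE unitfE negbK.
      rewrite (expand_det_row _ i) big1// => j _.
      by move/rowP/(_ j): Pi0; rewrite !mxE => ->; rewrite mul0r.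
    rewrite EA -row_mul !mulmxA mulmxV// mul1mx row_mul row_diag_mx -scalemxAl.
    by rewrite -rowE mxE.
  (* The characteristic polynomial of [A] is real, so the real number [d 0 i] is an eigenvalue over
     R as well and has a real eigenvector, on which positivity can be tested. *)
  rewrite !eigenvalue_root_char -map_char_poly fmorph_root -eigenvalue_root_char.
  move=> /eigenvalueP[v vA v0].
  have vT0 : v^T != 0 by rewrite trmx_eq0.
  have := Apos _ vT0; rewrite trmxK vA -scalemxAl mxE pmulr_lgt0//.
  by rewrite -[v in v *m _]trmxK; exact: tr_mul_gt0.
have [p pE] := poly_interpolation (fun x => Num.sqrt (Num.sqrt x))
  [seq d 0 i | i <- enum 'I_n.+1].
pose T := horner_mx A p.
have Ts : T^T = T by rewrite tr_horner_mx As.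
have T4 : (T *m T) *m (T *m T) = A.
  apply: (map_mx_inj (f := toC)).
  rewrite -[_ *m _]/((T * T) * (T * T)) -!rmorphM map_horner_mx EA.
  rewrite horner_mx_uconjC// horner_mx_diag; congr (_ *m diag_mx _ *m _).
  apply/rowP => i; rewrite !mxE horner_map; congr (_%:C)%C.
  rewrite !hornerM pE; last by apply: map_f; rewrite mem_enum.
  by rewrite -!expr2 sqr_sqrtr ?sqrtr_ge0// sqr_sqrtr// ltW.
exists (T *m T); split => //; first by rewrite trmx_mul Ts.
move=> v v0; have Tv0 : T *m v != 0.
  apply: contraTneq (Apos _ v0) => Tv0.
  by rewrite -T4 -!mulmxA Tv0 !mulmx0 mxE ltxx.
rewrite mulmxA -mulmxA -{1}Ts -trmx_mul.
exact: tr_mul_gt0.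
Qed.

End spd_sqrt_existence.

(** * Affine changes of variables in the Lebesgue integral *)

Section measurable_cV.
Context {R : realType} d (T : measurableType d) {n : nat}.
Implicit Types f g : T -> 'cV[R]_n.

Lemma measurable_cV_coord f i : measurable_fun setT f ->
  measurable_fun setT (fun x => f x i 0).
Proof. by move=> mf; apply: (measurableT_comp (measurable_coord i)). Qed.

Lemma measurable_cVD f g : measurable_fun setT f -> measurable_fun setT g ->
  measurable_fun setT (fun x => f x + g x).
Proof.
move=> mf mg; apply: measurable_cVP => i; under eq_fun do rewrite mxE.
by apply: measurable_funD; exact: measurable_cV_coord.
Qed.

Lemma measurable_cVZ (k : T -> R) f : measurable_fun setT k ->
  measurable_fun setT f -> measurable_fun setT (fun x => k x *: f x).
Proof.
move=> mk mf; apply: measurable_cVP => i; under eq_fun do rewrite mxE.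
by apply: measurable_funM => //; exact: measurable_cV_coord.
Qed.

Lemma measurable_mulmx m (A : 'M[R]_(m, n)) f : measurable_fun setT f ->
  measurable_fun setT (fun x => A *m f x).
Proof.
move=> mf; apply: measurable_cVP => i; under eq_fun do rewrite mxE.
apply: measurable_sum => j; apply: measurable_funM => //.
exact: measurable_cV_coord.
Qed.

End measurable_cV.

Lemma cV_consE (R : realType) n (p : R * 'cV[R]_n) :
  cV_cons p = col_mx p.1%:M p.2 :> 'cV[R]_(1 + n).
Proof.
apply/colP => i; case: (unliftP ord0 i) => [j|] ->.
  transitivity ((col_mx p.1%:M p.2 : 'cV[R]_(1 + n)) (rshift 1 j) 0).
    by rewrite cV_consS col_mxEd.
  by congr (_ _ _); exact/val_inj.
transitivity ((col_mx p.1%:M p.2 : 'cV[R]_(1 + n)) (lshift n 0) 0).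
  by rewrite cV_cons0 col_mxEu mxE.
by congr (_ _ _); exact/val_inj.
Qed.

Lemma cV_unconsK (R : realType) n : cancel (@cV_uncons R n) (@cV_cons R n).
Proof.
move=> v; apply/colP => i; case: (unliftP ord0 i) => [j|] ->.
  by rewrite cV_consS mxE.
by rewrite cV_cons0.
Qed.

Section fubini_cV.
Context {R : realType} (n : nat).
Variable f : 'cV[R]_n.+1 -> \bar R.
Hypothesis mf : measurable_fun setT f.
Hypothesis f0 : forall v, (0 <= f v)%E.

Lemma ge0_integral_cV_cons : (\int[lebesgue_cV n.+1]_v f v =
  \int[lebesgue_measure]_x \int[lebesgue_cV n]_y f (cV_cons (x, y)))%E.
Proof.
have mc : measurable_fun (setT : set (measurableTypeR R * 'cV[R]_n)%type)
  (@cV_cons R n) by exact: measurable_cV_cons.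
pose m : {measure set (measurableTypeR R * 'cV[R]_n) -> \bar R} :=
  (@lebesgue_measure R \x lebesgue_cV n)%E.
transitivity (\int[m]_(x in (@cV_cons R n) @^-1` setT) (f \o @cV_cons R n) x)%E.
  exact: (ge0_integral_pushforward mc m measurableT mf (fun v _ => f0 v)).
rewrite preimage_setT.
exact: (@fubini_tonelli1 _ _ (measurableTypeR R) 'cV[R]_n R lebesgue_measure
  (lebesgue_cV n) _ (measurableT_comp mf mc) (fun p => f0 (cV_cons p))).
Qed.

Lemma ge0_integral_cV_cons_swap : (\int[lebesgue_cV n.+1]_v f v =
  \int[lebesgue_cV n]_y \int[lebesgue_measure]_x f (cV_cons (x, y)))%E.
Proof.
rewrite ge0_integral_cV_cons.
have mc : measurable_fun (setT : set (measurableTypeR R * 'cV[R]_n)%type)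
  (@cV_cons R n) by exact: measurable_cV_cons.
exact: (@fubini_tonelli _ _ (measurableTypeR R) 'cV[R]_n R lebesgue_measure
  (lebesgue_cV n) _ (measurableT_comp mf mc) (fun p => f0 (cV_cons p))).
Qed.

End fubini_cV.

Section affine_substitution.
Context {R : realType}.
Local Notation mu := (@lebesgue_measure R).

(** Half-open intervals determine Lebesgue measure, and [a] times the image of Lebesgue measure
    under [phi] gives each of them its length. *)
Lemma ge0_integral_affine (a s : R) (f : R -> \bar R) : 0 < a ->
  measurable_fun setT f -> (forall x, 0 <= f x)%E ->
  (\int[mu]_x f (a * x + s)%R = a^-1%:E * \int[mu]_x f x)%E.
Proof.
move=> a0 mf f0; pose phi (x : measurableTypeR R) : measurableTypeR R := a * x + s.
have mphi : measurable_fun setT phi.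
  by apply: measurable_funD => //; apply: measurable_funM.
pose nu := mscale (NngNum (ltW a0))
  (measure_function_pushforward__canonical__measure_function_Measure mu mphi).
have muE A : measurable A -> mu A = nu A.
  move=> mA; apply: lebesgue_measure_unique => // _ [[u v]] _ <-.
  rewrite [RHS](_ : _ = a%:E * mu (phi @^-1` `]u, v]%classic))%E//.
  rewrite (_ : phi @^-1` _ = `](u - s) / a, (v - s) / a]%classic); last first.
    apply/seteqP; split => x /=; rewrite !in_itv/= ltr_pdivrMr// ler_pdivlMr//;
      by rewrite /phi ltrBlDr lerBrDr [x * a]mulrC.
  rewrite !lebesgue_measure_itv/= !lte_fin ltr_pM2r ?invr_gt0// ltrD2r.
  case: ifPn => _; last by rewrite mule0.
  by rewrite -!EFinD -EFinM; congr EFin; field; rewrite gt_eqF.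
have -> : (\int[mu]_x f x = \int[nu]_x f x)%E.
  by apply: eq_measure_integral => A mA _; exact: muE.
rewrite /nu ge0_integral_mscale//.
rewrite (ge0_integral_pushforward mphi mu measurableT mf (fun v _ => f0 v)).
by rewrite preimage_setT muleA -EFinM mulVf ?gt_eqF// mul1e.
Qed.

End affine_substitution.

Section spd.
Context {R : realType}.

Lemma spd_unitmx n (S : 'M[R]_n) : spd S -> S \in unitmx.
Proof.
move=> [Ss Spos]; rewrite unitmxE unitfE; apply/negP => /det0P[v v0 vS].
have vT0 : v^T != 0 by rewrite trmx_eq0.
by have := Spos _ vT0; rewrite trmxK vS mul0mx mxE ltxx.
Qed.

Lemma spd_invmx n (S : 'M[R]_n) : spd S -> spd (invmx S).
Proof.
move=> spdS; have Su := spd_unitmx spdS; have [Ss Spos] := spdS.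
split=> [|v v0]; first by rewrite trmx_inv Ss.
have /Spos : invmx S *m v != 0.
  by apply: contraNneq v0 => /(congr1 (mulmx S)); rewrite mulKVmx// mulmx0 => ->.
by rewrite trmx_mul trmx_inv Ss -!mulmxA mulKVmx.
Qed.

(** [spd_sqrt] is a choice that defaults to 0; existence of one root turns it into a genuine root.
    Later arguments use the root through these two properties. *)
Lemma spd_sqrtP n (A : 'M[R]_n) : spd A ->
  spd (spd_sqrt A) /\ spd_sqrt A *m spd_sqrt A = A.
Proof.
move=> [As Apos]; have [S [Ss Spos SS]] := spd_sqrt_exists As Apos.
by rewrite /spd_sqrt; case: xgetP => [B _ //|/(_ S)[]].
Qed.

Lemma spd_scalar n (c : R) : 0 < c -> spd (c%:M : 'M[R]_n).
Proof.
move=> c0; split=> [|v v0]; first exact: tr_scalar_mx.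
by rewrite -mulmxA mul_scalar_mx -scalemxAr mxE mulr_gt0// tr_mul_gt0.
Qed.

Section schur.
Variables (n : nat) (a : R) (b : 'cV[R]_n) (C : 'M[R]_n).
Local Notation B := (block_mx a%:M b^T b C : 'M[R]_(1 + n)).
Local Notation C' := (C - a^-1 *: (b *m b^T)).

Lemma det_schur : a != 0 -> \det B = a * \det C'.
Proof.
move=> a0.
have -> : B = block_mx 1%:M 0 (a^-1 *: b) 1%:M *m block_mx a%:M b^T 0 C'.
  rewrite mulmx_block !(mul1mx, mul0mx, mulmx0, addr0) mul_mx_scalar scalerA.
  by rewrite divff// scale1r -scalemxAl addrC subrK.
by rewrite det_mulmx det_lblock det_ublock !det1 !mul1r det_scalar1.
Qed.

Lemma spd_schur : spd B -> 0 < a /\ spd C'.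
Proof.
move=> [Bs Bpos].
have qE (u : 'cV[R]_1) (w : 'cV[R]_n) : (col_mx u w)^T *m B *m col_mx u w =
    (a *: (u^T *m u) + w^T *m b *m u) + (u^T *m b^T *m w + w^T *m C *m w).
  by rewrite tr_col_mx mul_row_block mul_row_col !mulmxDl mul_mx_scalar scalemxAl addrA.
have a0 : 0 < a.
  have : col_mx 1%:M 0 != 0 :> 'cV[R]_(1 + n).
    by rewrite col_mx_eq0 negb_and oner_eq0.
  move/Bpos; rewrite qE !(trmx0, mulmx0, mul0mx, addr0) trmx1 mul1mx.
  by rewrite !mxE mulr1.
split=> //; split=> [|w w0].
  have [_ _ _ Cs] : [/\ (a%:M : 'M[R]_1)^T = a%:M, b^T = b^T, b^T^T = b & C^T = C].
    by move: Bs; rewrite tr_block_mx => /eq_block_mx[].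
  by rewrite linearB linearZ /= trmx_mul trmxK Cs.
(* For fixed [w] this first coordinate minimizes the quadratic form of [B], and the minimum is the
   form of the Schur complement at [w]. *)
have : col_mx (- a^-1 *: (b^T *m w)) w != 0 :> 'cV[R]_(1 + n).
  by rewrite col_mx_eq0 negb_and w0 orbT.
move/Bpos; rewrite qE; congr (0 < _); congr (fun_of_matrix _ 0 0).
have -> : (- a^-1 *: (b^T *m w))^T = - a^-1 *: (w^T *m b).
  by rewrite linearZ /= trmx_mul trmxK.
rewrite mulmxBr mulmxBl.
rewrite -!(scalemxAl, scalemxAr) !mulmxA !scalerA addrA -!scalerDl addrC.
by rewrite -scaleNr; congr (_ + _ *: _); field; rewrite gt_eqF.
Qed.

End schur.

Lemma block_schur n (S : 'M[R]_(1 + n)) : S^T = S ->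
  exists (a : R) (b : 'cV[R]_n) (C : 'M[R]_n), S = block_mx a%:M b^T b C.
Proof.
move=> Ss; exists (ulsubmx S 0 0), (dlsubmx S), (drsubmx S).
by rewrite -mx11_scalar trmx_dlsub Ss submxK.
Qed.

Lemma spd_det_gt0 n (S : 'M[R]_n) : spd S -> 0 < \det S.
Proof.
elim: n S => [|n IH] S spdS; first by rewrite det_mx00.
have [a [b [C ES]]] := @block_schur n S spdS.1.
move: spdS; rewrite ES => /spd_schur[a0 /IH C0].
by rewrite det_schur ?gt_eqF// mulr_gt0.
Qed.

(* Eliminating the first coordinate of S v + s leaves the Schur complement
   acting on the others, which is again positive definite, so no pivoting is
   needed in the induction. *)
Lemma ge0_integral_spd_affine n (S : 'M[R]_n) (s : 'cV[R]_n)
    (f : 'cV[R]_n -> \bar R) :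
  spd S -> measurable_fun setT f -> (forall v, 0 <= f v)%E ->
  (\int[lebesgue_cV n]_v f (S *m v + s)%R =
   (\det S)^-1%:E * \int[lebesgue_cV n]_v f v)%E.
Proof.
elim: n S s f => [|n IH] S s f spdS mf f0.
  rewrite det_mx00 invr1 mul1e; apply: eq_integral => v _; congr f.
  by apply/matrixP => -[].
have [a [b [C ES]]] := @block_schur n S spdS.1.
have [a0 spdC] : 0 < a /\ spd (C - a^-1 *: (b *m b^T)).
  by apply: spd_schur; rewrite -ES.
have detS : \det S = a * \det (C - a^-1 *: (b *m b^T)).
  by rewrite ES det_schur// gt_eqF.
set C' := C - _ in spdC detS.
pose s0 := s ord0 0; pose s1 : 'cV[R]_n := \col_i s (lift ord0 i) 0.
have Es : s = cV_cons (s0, s1) by rewrite -[LHS]cV_unconsK.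
(* With t = a x + b^T y + s0 as new first coordinate, x = (t - s0 - b^T y) / a. Substituted in the
   lower block, the part in y turns [C] into [C'], and the remainder is the translation [s' t]. *)
pose s' (t : R) : 'cV[R]_n := (a^-1 * (t - s0)) *: b + s1.
pose g (p : R * 'cV[R]_n) := f (cV_cons (p.1, C' *m p.2 + s' p.1)).
have mg : measurable_fun setT g.
  apply: (measurableT_comp mf).
  apply: (measurableT_comp (@measurable_cV_cons R n)).
  apply: measurable_fun_pair => //=.
  apply: measurable_cVD; first by apply: measurable_mulmx.
  apply: measurable_cVD => //; apply: measurable_cVZ => //.
  by apply: measurable_funM => //; apply: measurable_funB.
have mfS : measurable_fun setT (fun v => f (S *m v + s)).
  by apply: (measurableT_comp mf); apply: measurable_cVD => //; exact: measurable_mulmx.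
rewrite ge0_integral_cV_cons_swap//.
have Eg x y : f (S *m cV_cons (x, y) + s) =
    g (a * x + ((b^T *m y) 0 0 + s0), y).
  pose t := a * x + ((b^T *m y) 0 0 + s0).
  have E : block_mx a%:M b^T b C *m col_mx x%:M y + col_mx s0%:M s1 =
      col_mx t%:M (C' *m y + s' t) :> 'cV[R]_(1 + n).
    rewrite mul_block_col add_col_mx; congr col_mx.
      rewrite /t; move: (b^T *m y) => u; apply/matrixP => i j.
      by rewrite !ord1 mul_scalar_mx !mxE !mulr1n addrA.
    have -> : s' t = x *: b + (a^-1 * (b^T *m y) 0 0) *: b + s1.
      rewrite /s' -scalerDl; congr (_ *: _ + _); rewrite /t.
      by field; rewrite gt_eqF.
    have -> : b *m x%:M + C *m y = x *: b + C *m y by rewrite mul_mx_scalar.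
    rewrite mulmxBl -scalemxAl -mulmxA.
    move: (b^T *m y) => u; rewrite {1}[u]mx11_scalar mul_mx_scalar.
    rewrite scalerA !addrA; congr (_ + _).
    by rewrite addrAC addrNK addrC.
  by rewrite /g /=; congr f; rewrite Es !cV_consE ES; exact: E.
under eq_integral => y _.
  under eq_integral do rewrite Eg.
  rewrite (@ge0_integral_affine _ a _ (fun t => g (t, y)))//; last 2 first.
  - exact: (measurableT_comp mg (pair2_measurable y)).
  - by move=> ?; exact: f0.
  over.
rewrite ge0_integralZl//; last 3 first.
- exact: (@measurable_fun_fubini_tonelli_G _ _ (measurableTypeR R) 'cV[R]_n R
    lebesgue_measure g mg (fun p => f0 _)).
- by move=> y _; apply: integral_ge0 => t _; exact: f0.
- by rewrite lee_fin invr_ge0 ltW.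
(* Now that t has replaced x, the integrals are exchanged back: for fixed t the inner one is an
   affine substitution in y, as in the induction hypothesis. *)
rewrite -(@fubini_tonelli _ _ (measurableTypeR R) 'cV[R]_n R lebesgue_measure
  (lebesgue_cV n) g mg (fun p => f0 _)).
have IHt t : (\int[lebesgue_cV n]_y g (t, y) =
    (\det C')^-1%:E * \int[lebesgue_cV n]_y f (cV_cons (t, y)))%E.
  apply: (IH C' (s' t) (fun y => f (cV_cons (t, y)))) => //.
  apply: (measurableT_comp mf).
  exact: (measurableT_comp (@measurable_cV_cons R n) (pair1_measurable t)).
under eq_integral do rewrite IHt.
rewrite ge0_integralZl//; last 3 first.
- apply: (@measurable_fun_fubini_tonelli_F _ _ (measurableTypeR R) 'cV[R]_n R
    (lebesgue_cV n) (f \o @cV_cons R n)); last by move=> p; exact: f0.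
  exact: (measurableT_comp mf (@measurable_cV_cons R n)).
- by move=> y _; apply: integral_ge0 => t _; exact: f0.
- by rewrite lee_fin invr_ge0 ltW// spd_det_gt0.
by rewrite ge0_integral_cV_cons// muleA -EFinM -invfM detS mulrC.
Qed.

End spd.

(** * The standard Gaussian measure *)

Section gaussian_density.
Context {R : realType}.

Definition sqnorm n (v : 'cV[R]_n) : R := \sum_i v i 0 ^+ 2.

Definition gauss_pdf n (v : 'cV[R]_n) : R :=
  normal_peak 1 ^+ n * expR (- (sqnorm v / 2)).

Lemma sqnorm_ge0 n (v : 'cV[R]_n) : 0 <= sqnorm v.
Proof. by apply: sumr_ge0 => i _; exact: sqr_ge0. Qed.

Lemma sqnormE n (v : 'cV[R]_n) : sqnorm v = (v^T *m v) 0 0.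
Proof. by rewrite mxE; apply: eq_bigr => i _; rewrite mxE expr2. Qed.

Lemma sqnormZ n (c : R) (v : 'cV[R]_n) : sqnorm (c *: v) = c ^+ 2 * sqnorm v.
Proof. by rewrite mulr_sumr; apply: eq_bigr => i _; rewrite mxE exprMn. Qed.

Lemma enormE n (v : 'cV[R]_n) : enorm v = Num.sqrt (sqnorm v).
Proof. by []. Qed.

Lemma measurable_sqnorm n : measurable_fun setT (@sqnorm n).
Proof.
apply: measurable_sum => i; apply: measurable_funX; exact: measurable_coord.
Qed.

Lemma gauss_pdf_ge0 n (v : 'cV[R]_n) : 0 <= gauss_pdf v.
Proof. by rewrite mulr_ge0 ?exprn_ge0 ?normal_peak_ge0 ?expR_ge0. Qed.

Lemma measurable_gauss_pdf n : measurable_fun setT (@gauss_pdf n).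
Proof.
apply: measurable_funM => //; apply: measurableT_comp => //.
apply: measurableT_comp => //; apply: measurable_funM => //.
exact: measurable_sqnorm.
Qed.

Lemma gauss_pdfE n (v : 'cV[R]_n) :
  gauss_pdf v = \prod_i normal_pdf 0 1 (v i 0).
Proof.
rewrite normal_pdfE// big_split /= big_const_ord iter_mulr_1.
rewrite -expR_sum; congr (_ * expR _).
rewrite mulr_suml -sumrN; apply: eq_bigr => i _.
by rewrite subr0 expr1n mulNr.
Qed.

Lemma measurable_box n (A : 'I_n -> set R) : (forall i, measurable (A i)) ->
  measurable (box A).
Proof.
move=> mA; rewrite (_ : box _ =
    \big[setI/setT]_(i < n) ((fun v : 'cV[R]_n => v i 0) @^-1` A i)).
  apply: bigsetI_measurable => i _; rewrite -[X in measurable X]setTI.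
  exact: measurable_coord.
rewrite -bigcap_seq; apply/seteqP; split=> v /= Av i; first by move=> _; exact: Av.
by apply: Av; exact: mem_index_enum.
Qed.

Lemma box_setT n : box (fun _ : 'I_n => setT : set R) = setT.
Proof. by apply/seteqP; split. Qed.

(* Boxes with measurable sides form a generating pi-system. *)
Lemma measure_box_unique n (m1 m2 : {measure set 'cV[R]_n -> \bar R}) :
  (m1 setT < +oo)%E ->
  (forall A : 'I_n -> set R, (forall i, measurable (A i)) ->
     m1 (box A) = m2 (box A)) ->
  forall B, measurable B -> m1 B = m2 B.
Proof.
move=> m1T m12 B mB.
pose G := [set box A | A in [set A : 'I_n -> set R | forall i, measurable (A i)]].
apply: (@measure_unique _ R _ G (fun=> setT)) => //.
- apply/seteqP; split.
    apply: smallest_sub; first exact: smallest_sigma_algebra.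
    move=> _ [i [A mA ->]]; apply: sub_sigma_algebra.
    exists (fun j => if j == i then A else setT); first by move=> j; case: ifP.
    apply/seteqP; split => v /=; first by move=> /(_ i); rewrite eqxx.
    by move=> Av j; case: eqP => [->|].
  apply: smallest_sub; first exact: sigma_algebra_measurable.
  by move=> _ [A mA <-]; exact: measurable_box.
- move=> _ _ [A1 mA1 <-] [A2 mA2 <-]; exists (fun i => A1 i `&` A2 i).
    by move=> i; exact: measurableI.
  apply/seteqP; split => v /=; first by move=> Av; split => i; case: (Av i).
  by move=> [A1v A2v] i; split.
- by move=> _; exists (fun=> setT); rewrite ?box_setT.
- by rewrite bigcup_const.
- by move=> _ [A mA <-]; exact: m12.
Qed.

Lemma ge0_integral_prod_coord n (h : 'I_n -> R -> R) :
  (forall i, measurable_fun setT (h i)) -> (forall i x, 0 <= h i x) ->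
  (\int[lebesgue_cV n]_v (\prod_i h i (v i 0))%:E =
   \prod_i \int[lebesgue_measure]_x (h i x)%:E)%E.
Proof.
elim: n h => [|n IH] h mh h0.
  rewrite big_ord0; under eq_integral do rewrite big_ord0.
  by rewrite integral_dirac//= diracE mem_set// mule1.
have mp k (g : 'I_k -> R -> R) : (forall i, measurable_fun setT (g i)) ->
    measurable_fun setT (fun v : 'cV[R]_k => (\prod_i g i (v i 0))%:E).
  move=> mg; apply/measurable_EFinP; apply: measurable_prod => i _.
  exact: (measurableT_comp (mg i) (measurable_coord i)).
rewrite big_ord_recl -(IH (fun i => h (lift ord0 i)))//.
rewrite ge0_integral_cV_cons; last 2 first.
- exact: mp.
- by move=> v; rewrite lee_fin prodr_ge0.
have E x y : (\prod_i h i (cV_cons (x, y) i 0))%:E =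
    ((h ord0 x)%:E * (\prod_i h (lift ord0 i) (y i 0))%:E)%E.
  rewrite big_ord_recl cV_cons0 EFinM; congr (_ * _%:E)%E.
  by apply: eq_bigr => i _; rewrite cV_consS.
have E' x : (\int[lebesgue_cV n]_y (\prod_i h i (cV_cons (x, y) i 0))%:E =
    (h ord0 x)%:E *
    \int[lebesgue_cV n]_y (\prod_i h (lift ord0 i) (y i 0))%:E)%E.
  under eq_integral do rewrite E.
  rewrite ge0_integralZl ?lee_fin//.
  - exact: (mp _ (fun i => h (lift ord0 i)) (fun i => mh _)).
  - by move=> v _; rewrite lee_fin prodr_ge0.
under eq_integral do rewrite E'.
rewrite ge0_integralZr//; last 3 first.
- by apply/measurable_EFinP; exact: mh.
- by move=> x _; rewrite lee_fin.
- by apply: integral_ge0 => v _; rewrite lee_fin prodr_ge0.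
Qed.

Definition gauss_measure n : set 'cV[R]_n -> \bar R :=
  fun B => (\int[lebesgue_cV n]_(v in B) (gauss_pdf v)%:E)%E.

Section gauss_measure.
Variable n : nat.
Local Notation gauss_measure := (@gauss_measure n).

Let gauss_measure0 : gauss_measure set0 = 0%E.
Proof. exact: integral_set0. Qed.

Let gauss_measure_ge0 B : (0 <= gauss_measure B)%E.
Proof. by apply: integral_ge0 => v _; rewrite lee_fin gauss_pdf_ge0. Qed.

Let gauss_measure_sigma_additive : semi_sigma_additive gauss_measure.
Proof.
apply: semi_sigma_additive_nng_induced.
  by apply/measurable_EFinP; exact: measurable_gauss_pdf.
by move=> v; rewrite lee_fin gauss_pdf_ge0.
Qed.

HB.instance Definition _ := isMeasure.Build _ _ _ gauss_measure
  gauss_measure0 gauss_measure_ge0 gauss_measure_sigma_additive.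

End gauss_measure.

Lemma gauss_measure_box n (A : 'I_n -> set R) :
  (forall i, measurable (A i)) ->
  gauss_measure (box A) = (\prod_(i < n) normal_prob 0 1 (A i))%E.
Proof.
move=> mA; rewrite /gauss_measure integral_mkcond.
(* The indicator of a box is the product of the indicators of its sides, so the integrand factors
   over the coordinates. *)
rewrite (eq_integral (fun v : 'cV[R]_n =>
    (\prod_i (normal_pdf 0 1 (v i 0) * \1_(A i) (v i 0)))%:E)); last first.
  move=> v _; rewrite patchE; case: ifPn => vA.
    rewrite gauss_pdfE; congr EFin; apply: eq_bigr => i _.
    by rewrite indicE mem_set ?mulr1//; move: vA; rewrite inE; exact.
  have [i vi] : exists i, ~ A i (v i 0).
    by apply/existsNP => Av; move: vA; rewrite mem_set.
  by rewrite (bigD1 i)//= indicE memNset// mulr0 mul0r.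
rewrite (@ge0_integral_prod_coord _
    (fun i x => normal_pdf 0 1 x * \1_(A i) x)); last 2 first.
- by move=> i; apply: measurable_funM; [exact: measurable_normal_pdf|exact: measurable_indic].
- by move=> i x; rewrite mulr_ge0// normal_pdf_ge0.
apply: eq_bigr => i _; rewrite /normal_prob [RHS]integral_mkcond.
apply: eq_integral => x _; rewrite patchE indicE.
by case: ifPn => _; rewrite ?mulr1 ?mulr0.
Qed.

Lemma gauss_measureT n : gauss_measure [set: 'cV[R]_n] = 1%E.
Proof.
rewrite -box_setT gauss_measure_box//.
by rewrite big1// => i _; exact: (@probability_setT _ _ _ (normal_prob 0 1)).
Qed.

Section law.
Context {disp : measure_display} {Omega : measurableType disp}
  {P : probability Omega R} (n : nat) (Z : {RV P >-> 'cV[R]_n}).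
Hypothesis gZ : std_gaussian Z.

Lemma std_gaussian_law B : measurable B ->
  distribution P Z B = gauss_measure B.
Proof.
move=> mB; apply: measure_box_unique => //.
  by rewrite (le_lt_trans (probability_le1 _ _))// ltry.
move=> A mA; transitivity (\prod_(i < n) normal_prob 0 1 (A i))%E.
  exact: gZ.
exact/esym/gauss_measure_box.
Qed.

End law.

End gaussian_density.

(** * Privacy of Gaussian families *)

Section quadratic_form.
Context {R : realType} {n : nat} (G : 'M[R]_n).

Definition qform (v : 'cV[R]_n) : R := (v^T *m G *m v) 0 0.

Lemma measurable_qform d (T : measurableType d) (f : T -> 'cV[R]_n) :
  measurable_fun setT f -> measurable_fun setT (fun x => qform (f x)).
Proof.
move=> mf; rewrite /qform; under eq_fun do rewrite -mulmxA mxE.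
apply: measurable_sum => i; under eq_fun do rewrite mxE.
apply: measurable_funM; first exact: measurable_cV_coord.
by apply: measurable_cV_coord; exact: measurable_mulmx.
Qed.

(** Expansion of the polar form [B]. For alpha > 1 the combination extrapolates: alpha (1 - alpha)
    is negative, and this term becomes the positive divergence. *)
Lemma qform_convex (alpha : R) (u w : 'cV[R]_n) : G^T = G ->
  alpha * qform u + (1 - alpha) * qform w =
  qform (alpha *: u + (1 - alpha) *: w) + alpha * (1 - alpha) * qform (w - u).
Proof.
move=> Gs; pose B (x y : 'cV[R]_n) := (x^T *m G *m y) 0 0.
have BC x y : B x y = B y x.
  rewrite /B; transitivity ((x^T *m G *m y)^T 0 0); first by rewrite [RHS]mxE.
  by rewrite !trmx_mul trmxK Gs mulmxA.
have BDl x y z : B (x + y) z = B x z + B y z.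
  by rewrite /B linearD /= !mulmxDl mxE.
have BZl c x y : B (c *: x) y = c * B x y.
  by rewrite /B linearZ /= -!scalemxAl mxE.
have BDr x y z : B x (y + z) = B x y + B x z by rewrite BC BDl (BC y) (BC z).
have BZr c x y : B x (c *: y) = c * B x y by rewrite BC BZl (BC y).
have QE x : qform x = B x x by [].
rewrite !QE -(scaleN1r u) !(BDl, BDr, BZl, BZr) (BC w u); ring.
Qed.

End quadratic_form.

Section densities.
Context {R : realType} {n : nat}.
Implicit Types (nu : probability 'cV[R]_n R) (p q : 'cV[R]_n -> R).

(** [CGP] is asserted for arbitrary densities of the laws; this replaces them by the explicit
    Gaussian ones under the Renyi integral. *)
Lemma has_density_ae_unique nu p q : has_density nu p -> has_density nu q ->
  {ae lebesgue_cV n, forall y, p y = q y}.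
Proof.
move=> [mp p0 nup] [mq q0 nuq].
have : ae_eq (lebesgue_cV n) setT (EFin \o p) (EFin \o q).
  apply: integral_ae_eq => //.
  - apply/integrableP; split; first exact/measurable_EFinP.
    under eq_integral do rewrite /= ger0_norm//.
    by rewrite -nup// probability_setT ltry.
  - exact/measurable_EFinP.
  - by move=> E _ mE; rewrite -nup// -nuq.
by apply: filterS => y /(_ I)[].
Qed.

Lemma measurable_renyi_kernel (alpha : R) p q : measurable_fun setT p ->
  measurable_fun setT q ->
  measurable_fun setT (fun y => renyi_kernel alpha (p y) (q y)).
Proof.
move=> mp mq; apply: measurable_fun_ifT.
- exact: measurable_fun_eqr.
- apply: measurable_fun_ifT => //; exact: measurable_fun_eqr.
apply/measurable_EFinP; apply: measurable_funM.
  exact: (measurableT_comp (measurable_powR alpha)).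
exact: (measurableT_comp (measurable_powR (1 - alpha))).
Qed.

(* alpha Q(y - a) + (1 - alpha) Q(y - b) is Q recentred at
   alpha a + (1 - alpha) b plus a constant, so the Renyi integrand is a multiple
   of a third density of the family and the divergence is computed exactly. *)
Lemma renyi_div_gaussian (nu1 nu2 nu3 : probability 'cV[R]_n R)
    (G : 'M[R]_n) (rho c alpha : R) (a b : 'cV[R]_n) p q :
  G^T = G -> 1 < alpha -> 
  let g x y := expR (c - rho * qform G (y - x)) in
  has_density nu1 (g a) -> has_density nu2 (g b) ->
  has_density nu3 (g (alpha *: a + (1 - alpha) *: b)) ->
  has_density nu1 p -> has_density nu2 q ->
  renyi_div alpha p q = (alpha * rho * qform G (a - b))%:E.
Proof.
move=> Gs alpha1 g ga gb gm dp dq; rewrite /renyi_div.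
have kE y : renyi_kernel alpha (g a y) (g b y) =
    ((expR (alpha * (alpha - 1) * rho * qform G (a - b)))%:E *
    (g (alpha *: a + (1 - alpha) *: b) y)%:E)%E.
  rewrite /renyi_kernel gt_eqF ?expR_gt0// -EFinM /g -!expRM -!expRD.
  congr (expR _)%:E; have := qform_convex alpha (y - a) (y - b) Gs.
  have -> : y - b - (y - a) = a - b.
    by rewrite opprB addrC addrA subrK.
  have -> : alpha *: (y - a) + (1 - alpha) *: (y - b) =
     y - (alpha *: a + (1 - alpha) *: b).
    by rewrite !scalerBr addrACA -scalerDl subrKC scale1r -opprD.
  move: (qform G (y - a)) (qform G (y - b)) => u w E.
  transitivity (c - rho * (alpha * u + (1 - alpha) * w)); first by ring.
  by rewrite E; ring.
rewrite (_ : integral _ _ _ =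
    (expR (alpha * (alpha - 1) * rho * qform G (a - b)))%:E).
  rewrite lne_EFin ?expR_gt0// expRK -EFinM; congr EFin; field.
  by rewrite subr_eq0 gt_eqF.
transitivity (\int[lebesgue_cV n]_y renyi_kernel alpha (g a y) (g b y))%E.
  have [mp _ _] := dp; have [mq _ _] := dq.
  have [mga _ _] := ga; have [mgb _ _] := gb.
  apply: ae_eq_integral => //; [exact: measurable_renyi_kernel..|].
  apply: filterS2 (has_density_ae_unique dp ga) (has_density_ae_unique dq gb).
  by move=> y -> ->.
have [mgm gm0 gmE] := gm.
under eq_integral do rewrite kE.
rewrite ge0_integralZl ?lee_fin//; last 2 first.
- exact/measurable_EFinP.
- by move=> y _; rewrite lee_fin.
by rewrite -gmE// probability_setT mule1.
Qed.

(** The densities are assumed for the whole family because the computation also uses the law centred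
    at alpha a + (1 - alpha) b. The privacy bound holds with equality. *)
Lemma CGP_gaussian (law : 'cV[R]_n -> probability 'cV[R]_n R)
    (G : 'M[R]_n) (rho c : R) (dist : 'cV[R]_n -> 'cV[R]_n -> R) :
  G^T = G -> (forall a b, dist a b ^+ 2 = qform G (a - b)) ->
  (forall a, has_density (law a) (fun y => expR (c - rho * qform G (y - a)))) ->
  CGP dist rho law.
Proof.
move=> Gs distE dlaw; split=> [a|a b p q alpha dp dq alpha1].
  by exists (fun y => expR (c - rho * qform G (y - a))).
rewrite (@renyi_div_gaussian (law a) (law b) (law (alpha *: a + (1 - alpha) *: b))
  G rho c alpha a b p q)//.
by rewrite distE.
Qed.

End densities.

Section mechanism_density.
Context {R : realType} {disp : measure_display} {Omega : measurableType disp}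
  {P : probability Omega R} {n : nat} (Z : {RV P >-> 'cV[R]_n}).
Variables (rho : R) (Sigma : 'M[R]_n).
Hypotheses (gZ : std_gaussian Z) (rho0 : 0 < rho) (spdS : spd Sigma).

(** One constant serves all centres. Since alpha c + (1 - alpha) c = c, it carries over unchanged to
    the third density in the Renyi integrand, whatever its value. *)
Lemma gauss_mech_density : exists c, forall a,
  has_density (distribution P (gauss_mech rho Sigma Z a))
    (fun y => expR (c - rho * qform (invmx Sigma) (y - a))).
Proof.
have [spdT TT] := spd_sqrtP spdS.
set T := spd_sqrt Sigma in spdT TT.
pose r := (Num.sqrt (2 * rho))^-1.
have r0 : 0 < r by rewrite invr_gt0 sqrtr_gt0 mulr_gt0.
have spdrT : spd (r *: T).
  split=> [|v v0]; first by rewrite linearZ /= spdT.1.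
  by rewrite -scalemxAr -scalemxAl mxE mulr_gt0//; exact: spdT.2.
have rTu := spd_unitmx spdrT.
have detrT := spd_det_gt0 spdrT.
pose K := (\det (r *: T))^-1 * normal_peak 1 ^+ n.
have K0 : 0 < K by rewrite mulr_gt0 ?invr_gt0// exprn_gt0// normal_peak_gt0.
(* [T] is symmetric with square [Sigma], so the left form has matrix r^-2 Sigma^-1, and r^-2 = 2
   rho. *)
have sqE v : sqnorm (invmx (r *: T) *m v) / 2 = rho * qform (invmx Sigma) v.
  rewrite sqnormE trmx_mul trmx_inv (spdrT.1).
  have -> : v^T *m invmx (r *: T) *m (invmx (r *: T) *m v) =
      r ^- 2 *: (v^T *m invmx Sigma *m v).
    rewrite mulmxA -(mulmxA v^T) scalemxAl scalemxAr; congr (_ *m _ *m _).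
    rewrite invmxZ// -scalemxAl -scalemxAr scalerA -invfM -expr2.
    congr (_ *: _); rewrite -[LHS](mulKmx (spd_unitmx spdS)) -{2}TT.
    by rewrite !mulmxA !mulmxK ?(spd_unitmx spdT).
  rewrite mxE /qform /r -exprVn invrK sqr_sqrtr; last by rewrite mulr_ge0// ltW.
  by rewrite mulrAC -mulrA; field.
exists (ln K) => a.
have dE y : expR (ln K - rho * qform (invmx Sigma) (y - a)) =
    (\det (r *: T))^-1 * gauss_pdf (invmx (r *: T) *m (y - a)).
  by rewrite expRD lnK ?posrE// /gauss_pdf sqE mulrA.
have mya : measurable_fun setT (fun y : 'cV[R]_n => y - a) by exact: measurable_cVD.
split.
- apply: measurableT_comp => //; apply: measurable_funB => //.
  apply: measurable_funM => //; exact: measurable_qform.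
- by move=> y; exact: expR_ge0.
move=> A mA.
pose phi (z : 'cV[R]_n) : 'cV[R]_n := r *: T *m z + a.
have mphi : measurable_fun setT phi.
  by apply: measurable_cVD => //; exact: measurable_mulmx.
have mphiA : measurable (phi @^-1` A) by rewrite -[X in measurable X]setTI; exact: mphi.
transitivity (distribution P Z (phi @^-1` A)).
  rewrite /distribution /pushforward /=; congr (P _).
  apply/seteqP; split => w /=; rewrite /phi /gauss_mech -scalemxAl addrC//.
rewrite std_gaussian_law// /gauss_measure.
under [RHS]eq_integral do rewrite dE EFinM.
have mg : measurable_fun setT (fun y : 'cV[R]_n => (gauss_pdf (invmx (r *: T) *m (y - a)))%:E).
  apply/measurable_EFinP; apply: (measurableT_comp (@measurable_gauss_pdf _ _)).
  exact: measurable_mulmx.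
rewrite ge0_integralZl//; last 3 first.
- exact: measurable_funTS.
- by move=> y _; rewrite lee_fin gauss_pdf_ge0.
- by rewrite lee_fin invr_ge0 ltW.
rewrite [in RHS]integral_mkcond -(@ge0_integral_spd_affine _ _ _ a)//.

- rewrite [LHS]integral_mkcond; apply: eq_integral => z _; rewrite !patchE.
  rewrite (_ : (phi z \in A) = (z \in phi @^-1` A))//.
  by rewrite /phi addrK mulKmx.
- by apply/(measurable_restrictT _ _).1 => //; exact: measurable_funTS.
- by move=> y; rewrite patchE; case: ifP => // _; rewrite lee_fin gauss_pdf_ge0.
Qed.

End mechanism_density.

(** * Moments and tails of the Gaussian norm *)

Section radial.
Context {R : realType} {n : nat}.
Hypothesis n_gt0 : (0 < n)%N.
Local Notation mu := (@lebesgue_measure R).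
Local Notation q x := (@sqnorm R n x / 2).

Lemma ge0_integral_scale (r : R) (f : 'cV[R]_n -> \bar R) : 0 < r ->
  measurable_fun setT f -> (forall x, 0 <= f x)%E ->
  (\int[lebesgue_cV n]_x f (r *: x) = (r ^- n)%:E * \int[lebesgue_cV n]_x f x)%E.
Proof.
move=> r0 mf f0.
rewrite -(det_scalar n r) -(@ge0_integral_spd_affine _ _ _ 0)//; last exact: spd_scalar.
by apply: eq_integral => x _; rewrite mul_scalar_mx addr0.
Qed.

Lemma measurable_sqrt : measurable_fun setT (@Num.sqrt R).
Proof. by apply: nondecreasing_measurable => // x y xy; exact: ler_wsqrtr. Qed.

Lemma measurable_half_sqnorm : measurable_fun setT (fun x : 'cV[R]_n => q x).
Proof. by apply: measurable_funM => //; exact: measurable_sqnorm. Qed.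

Lemma half_sqnorm_ge0 (x : 'cV[R]_n) : 0 <= q x.
Proof. by rewrite divr_ge0// sqnorm_ge0. Qed.

Lemma half_sqnormZ (c : R) (x : 'cV[R]_n) : q (c *: x) = c ^+ 2 * q x.
Proof. by rewrite sqnormZ mulrA. Qed.

Lemma measurable_half_sqnormV : measurable_fun setT (fun x : 'cV[R]_n => (q x)^-1).
Proof.
under eq_fun do rewrite -powR_inv1 ?half_sqnorm_ge0//.
exact: (measurableT_comp (measurable_powR (-1)) measurable_half_sqnorm).
Qed.

(** The exceptional set is the origin, a box with sides {0}. It is null because the dimension is
    positive: in dimension 0 the measure is a point mass there. *)
Lemma ae_half_sqnorm_gt0 : {ae lebesgue_cV n, forall x, 0 < q x}.
Proof.
exists (box (fun=> [set 0])); split.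
- by apply: measurable_box => i.
- rewrite [LHS]lebesgue_cV_box// (eq_bigr (fun=> 0%E)); last first.
    by move=> i _; exact: lebesgue_measure_set1.
  by case: n n_gt0 => // k _; rewrite big_ord_recl mul0e.
move=> x /= /negP; rewrite -leNgt => qx i.
have : sqnorm x = 0.
  apply/eqP; rewrite eq_le sqnorm_ge0 andbT.
  by move: qx; rewrite ler_pdivrMr// mul0r.
move/eqP; rewrite psumr_eq0; last by move=> j _; exact: sqr_ge0.
by move/allP/(_ i); rewrite mem_index_enum sqrf_eq0 => /(_ isT)/eqP.
Qed.

(* The weight t ^ (k / 2 - 1), extended by 0 to t <= 0. *)
Definition radial_weight k (t : R) : R := Num.sqrt t ^+ k * t `^ (-1).

Lemma radial_weight_ge0 k t : 0 <= radial_weight k t.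
Proof. by rewrite mulr_ge0 ?exprn_ge0 ?sqrtr_ge0 ?powR_ge0. Qed.

Lemma radial_weight_le0 k t : (0 < k)%N -> t <= 0 -> radial_weight k t = 0.
Proof.
by move=> k0 t0; rewrite /radial_weight ler0_sqrtr// expr0n eqn0Ngt k0 mul0r.
Qed.

Lemma measurable_radial_weight k : measurable_fun setT (radial_weight k).
Proof.
apply: measurable_funM; last exact: measurable_powR.
by apply: measurable_funX; exact: measurable_sqrt.
Qed.

Lemma integral_dyadic (u : R) (c : \bar R) : 0 < u -> (0 <= c)%E ->
  (\int[mu]_t (if (u <= t <= 2 * u)%R then c * (u^-1)%:E else 0) = c)%E.
Proof.
move=> u0 c0.
transitivity (\int[mu]_(t in [set` `[u, 2 * u]%R]) cst (c * (u^-1)%:E) t)%E.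
  rewrite [RHS]integral_mkcond; apply: eq_integral => t _.
  by rewrite patchE mem_setE in_itv.
rewrite integral_cst//= lebesgue_measure_itv/= lte_fin ltr_pMl// ltr1n.
rewrite -EFinD -muleA -EFinM [X in (_ * X%:E)%E](_ : _ = 1) ?mule1//.
by field; rewrite gt_eqF.
Qed.

(** The integral of q^(-1 - n/2) over the shell 1/2 <= q <= 1, whose value is (2 pi)^(n/2) / Gamma
    (n / 2). It is kept abstract, possibly infinite at this point; the total mass of the Gaussian
    settles its finiteness. *)
Definition radial_const : \bar R := (\int[lebesgue_cV n]_x
  (if (q x <= 1 <= 2 * q x)%R then (q x)^-1 * (Num.sqrt (q x) ^- n) else 0)%:E)%E.

(* Radial integration without polar coordinates: insert
   1 = q(x)^-1 * |[q(x), 2 q(x)]| under the integral, exchange the integrals,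
   scale x by sqrt t, exchange back, and scale t by q(x)^-1. *)
Lemma ge0_integral_radial (h : R -> \bar R) :
  measurable_fun setT h -> (forall t, 0 <= h t)%E ->
  (\int[lebesgue_cV n]_x h (q x) =
   radial_const * \int[mu]_t (h t * (radial_weight n t)%:E))%E.
Proof.
move=> mh h0.
pose F (p : measurableTypeR R * 'cV[R]_n) : \bar R :=
  if (q p.2 <= p.1 <= 2 * q p.2)%R then (h (q p.2) * ((q p.2)^-1)%:E)%E else 0%E.
have mq2 : measurable_fun [set: measurableTypeR R * 'cV[R]_n] (fun p => q p.2).
  exact: (measurableT_comp measurable_half_sqnorm).
have mqV2 : measurable_fun [set: measurableTypeR R * 'cV[R]_n] (fun p => (q p.2)^-1).
  exact: (measurableT_comp measurable_half_sqnormV).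
have mF : measurable_fun setT F.
  apply: measurable_fun_ifT => //.
    apply: measurable_and; apply: measurable_fun_ler => //.
    by apply: measurable_funM.
  apply: emeasurable_funM; last exact/measurable_EFinP.
  exact: (measurableT_comp mh).
have F0 p : (0 <= F p)%E.
  rewrite /F; case: ifP => // _.
  by rewrite mule_ge0// lee_fin invr_ge0 half_sqnorm_ge0.
(* [F] after x is scaled by sqrt t: the Jacobian sqrt t ^ n and the factor 1 / (t q(x)) produce the
   radial weight, and the constraint between t and x becomes one on x alone. *)
pose G (p : measurableTypeR R * 'cV[R]_n) : \bar R :=
  if (q p.2 <= 1 <= 2 * q p.2)%R then
    (h (p.1 * q p.2)%R * (radial_weight n p.1 * (q p.2)^-1)%:E)%E else 0%E.
have mG : measurable_fun setT G.
  apply: measurable_fun_ifT => //.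
    apply: measurable_and; apply: measurable_fun_ler => //.
    by apply: measurable_funM.
  apply: emeasurable_funM.
    by apply: (measurableT_comp mh); apply: measurable_funM.
  apply/measurable_EFinP; apply: measurable_funM => //.
  exact: (measurableT_comp (measurable_radial_weight n)).
have G0 p : (0 <= G p)%E.
  rewrite /G; case: ifP => // _; rewrite mule_ge0// lee_fin mulr_ge0 ?invr_ge0//.
  - exact: radial_weight_ge0.
  - exact: half_sqnorm_ge0.
transitivity (\int[lebesgue_cV n]_x \int[mu]_t F (t, x))%E.
  apply: ae_eq_integral => //.
  - exact: (measurableT_comp mh measurable_half_sqnorm).
  - exact: measurable_fun_fubini_tonelli_G.
  by apply: filterS ae_half_sqnorm_gt0 => x qx _; rewrite /F/= integral_dyadic.
rewrite -(@fubini_tonelli _ _ (measurableTypeR R) 'cV[R]_n R mu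
  (lebesgue_cV n) F mF F0).
transitivity (\int[mu]_t \int[lebesgue_cV n]_x G (t, x))%E.
  apply: eq_integral => t _; have [t0|t0] := leP t 0.
    rewrite !integral0_eq//= => x _; rewrite /F /G/=; case: ifP => //.
      by rewrite radial_weight_le0// mul0r mule0.
    (* For t <= 0 the constraint leaves q(x) = 0, whose inverse is 0 by convention, so [F] vanishes
       like [G]. *)
    move=> /andP[qt _]; have -> : q x = 0.
      by apply/eqP; rewrite eq_le half_sqnorm_ge0 (le_trans qt).
    by rewrite invr0 mule0.
  have st0 : 0 < Num.sqrt t by rewrite sqrtr_gt0.
  have := @ge0_integral_scale (Num.sqrt t) (fun x => F (t, x)) st0
    (measurableT_comp mF (pair1_measurable t)) (fun x => F0 _).
  move=> /(congr1 (fun z => (Num.sqrt t ^+ n)%:E * z)%E).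
  rewrite muleA -EFinM mulfV ?mul1e ?expf_neq0 ?gt_eqF// => <-.
  rewrite -ge0_integralZl ?lee_fin ?exprn_ge0 ?sqrtr_ge0//; last first.
    apply: (measurableT_comp mF); apply: (measurableT_comp (pair1_measurable t)).
    exact: measurable_cVZ.
  apply: eq_integral => x _; rewrite /F /G /= half_sqnormZ sqr_sqrtr ?(ltW t0)//.
    rewrite ger_pMr// mulrCA ler_pMr//; case: ifP => _; last by rewrite mule0.
  rewrite muleCA -EFinM /radial_weight powR_inv1 ?(ltW t0)// invfM.
  by rewrite -mulrA.
rewrite (@fubini_tonelli _ _ (measurableTypeR R) 'cV[R]_n R mu
  (lebesgue_cV n) G mG G0).
rewrite /radial_const -ge0_integralZr//; last 3 first.
- apply/measurable_EFinP; apply: measurable_fun_ifT => //.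
    apply: measurable_and; apply: measurable_fun_ler => //.
    + exact: measurable_half_sqnorm.
    + by apply: measurable_funM => //; exact: measurable_half_sqnorm.
  apply: measurable_funM; first exact: measurable_half_sqnormV.
  rewrite (_ : (fun x => _) = fun x : 'cV[R]_n => (Num.sqrt (q x) ^+ n) `^ (-1));
    last by apply/funext => x; rewrite powR_inv1// exprn_ge0 ?sqrtr_ge0.
  apply: (measurableT_comp (measurable_powR (-1))); apply: measurable_funX.
  exact: (measurableT_comp measurable_sqrt measurable_half_sqnorm).
- move=> x _; rewrite lee_fin; case: ifP => // _.
  by rewrite mulr_ge0 ?invr_ge0 ?exprn_ge0 ?sqrtr_ge0 ?half_sqnorm_ge0.
- by apply: integral_ge0 => t _; rewrite mule_ge0// lee_fin radial_weight_ge0.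
apply: eq_integral => x _; rewrite /G/=; case: ifPn => [/andP[_ q2]|_]; last first.
  by rewrite integral0_eq// mul0e.
have q0 : 0 < q x by rewrite -(pmulr_rgt0 _ (@ltr0Sn R 1)) (lt_le_trans _ q2).
pose phi (t : R) : \bar R := (h t * (radial_weight n (t / q x) * (q x)^-1)%:E)%E.
(* The weight is homogeneous of degree n / 2 - 1, so together with the factor 1 / q(x) it releases
   q(x)^(-n/2). *)
have phiE t : phi t =
    ((Num.sqrt (q x) ^- n)%:E * (h t * (radial_weight n t)%:E))%E.
  rewrite muleCA -EFinM /phi; congr (_ * _%:E)%E; move: (q x) q0 => u q0.
  have [t0|t0] := leP t 0.
    by rewrite !radial_weight_le0// ?mul0r ?mulr0// pmulr_lle0// invr_gt0.
  rewrite /radial_weight !powR_inv1 ?divr_ge0 ?(ltW q0) ?(ltW t0)//.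
  rewrite sqrtrM ?(ltW t0)// sqrtrV ?(ltW q0)// exprMn exprVn invf_div.
  by field; rewrite !gt_eqF//= exprn_gt0// sqrtr_gt0.
have mhw : measurable_fun setT (fun t => h t * (radial_weight n t)%:E)%E.
  apply: emeasurable_funM => //; apply/measurable_EFinP.
  exact: measurable_radial_weight.
have hw0 t : (0 <= h t * (radial_weight n t)%:E)%E.
  by rewrite mule_ge0// lee_fin radial_weight_ge0.
have phi_fun : phi = fun t => ((Num.sqrt (q x) ^- n)%:E *
     (h t * (radial_weight n t)%:E))%E by exact/funext.
have sq0 : 0 <= Num.sqrt (q x) ^- n by rewrite invr_ge0 exprn_ge0 ?sqrtr_ge0.
rewrite EFinM -muleA -ge0_integralZl ?lee_fin// -phi_fun.
rewrite -(@ge0_integral_affine _ (q x) 0 phi)//.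
- apply: eq_integral => t _; rewrite addr0 /phi [q x * t]mulrC.
  by rewrite mulfK// gt_eqF.
- by rewrite phi_fun; exact: emeasurable_funM.
- by move=> t; rewrite phiE mule_ge0.
Qed.

End radial.

Section gaussian_moments.
Context {R : realType} {n : nat}.
Hypothesis n_gt0 : (0 < n)%N.
Local Notation mu := (@lebesgue_measure R).
Local Notation leb := (lebesgue_cV n).
Local Notation pdf := (@gauss_pdf R n).

Lemma Gamma_radial k : (0 < k)%N ->
  Gamma (k%:R / 2) = fine (\int[mu]_t (expR (- t) * radial_weight k t)%:E)%E :> R.
Proof.
move=> k0; rewrite /Gamma /Rintegral integral_mkcond; congr fine.
apply: eq_integral => t _; rewrite patchE mem_setE in_itv/= andbT.
case: ltP => t0; last by rewrite radial_weight_le0// mulr0.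
rewrite mulrC; congr (_ * _)%:E; rewrite /radial_weight.
rewrite -powR12_sqrt ?(ltW t0)// -powR_mulrn ?powR_ge0// -powRrM -powRD.
  by rewrite [2^-1 * _]mulrC.
by rewrite (gt_eqF t0) implybT.
Qed.

Lemma integral_gauss_radial (h : R -> R) : measurable_fun setT h ->
  (forall t, 0 <= h t) ->
  (\int[leb]_x (h (sqnorm x / 2) * pdf x)%:E =
   (normal_peak 1 ^+ n)%:E * @radial_const R n *
   \int[mu]_t (h t * expR (- t) * radial_weight n t)%:E)%E.
Proof.
move=> mh h0; have p0 : 0 <= normal_peak (1 : R) ^+ n.
  by rewrite exprn_ge0 ?normal_peak_ge0.
have mhe : measurable_fun setT (fun t => h t * expR (- t)).
  apply: measurable_funM => //; exact: measurableT_comp.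
rewrite -muleA.
rewrite -(@ge0_integral_radial _ _ n_gt0 (fun t => (h t * expR (- t))%:E)); last 2 first.
- exact/measurable_EFinP.
- by move=> t; rewrite lee_fin mulr_ge0 ?expR_ge0.
rewrite -ge0_integralZl ?lee_fin//; last 2 first.
- apply/measurable_EFinP.
  exact: (measurableT_comp mhe measurable_half_sqnorm).
- by move=> x _; rewrite lee_fin mulr_ge0 ?expR_ge0.
by apply: eq_integral => x _; rewrite -EFinM /gauss_pdf mulrCA.
Qed.

Lemma integral_gauss_pdf : (\int[leb]_x (pdf x)%:E = 1)%E.
Proof. exact: (@gauss_measureT R n). Qed.

(** The integrand is the density at s^-1 x, so scaling suffices. With u = 1 - s^-2, the value s^n is
    the classical (1 - u)^(-n/2). *)
Lemma gauss_mgf (s : R) : 0 < s ->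
  (\int[leb]_x (expR ((1 - s ^- 2) * (sqnorm x / 2)) * pdf x)%:E = (s ^+ n)%:E)%E.
Proof.
move=> s0; have := @ge0_integral_scale R n s^-1 (fun x => (pdf x)%:E).
rewrite invr_gt0 integral_gauss_pdf mule1 exprVn invrK => <-//.
- apply: eq_integral => x _; rewrite /gauss_pdf mulrCA -expRD; congr (_ * expR _)%:E.
  by rewrite sqnormZ exprVn; ring.
- by apply/measurable_EFinP; exact: measurable_gauss_pdf.
- by move=> x; rewrite lee_fin gauss_pdf_ge0.
Qed.

(** With l = 1 - s^-2, the moment generating function yields l M <= 2 (s^n - 1) for the second
    moment M. Expanding s^n - 1 as a geometric sum allows division by l and gives M <= n s^(n+2),
    which has the right limit as s tends to 1. *)
Lemma sub1_expr_le (s : R) : 1 < s ->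
  2 * (s ^+ n - 1) <= n%:R * s ^+ n.+2 * (1 - s ^- 2).
Proof.
move=> s1; have s0 : 0 < s by rewrite (lt_trans _ s1).
have sum_le : \sum_(i < n) s ^+ i <= n%:R * s ^+ n.
  apply: (@le_trans _ _ (\sum_(i < n) s ^+ n)).
    by apply: ler_sum => i _; rewrite ler_weXn2l ?(ltW s1)// ltnW.
  by rewrite sumr_const card_ord mulr_natl.
have -> : n%:R * s ^+ n.+2 * (1 - s ^- 2) = (n%:R * s ^+ n) * (s + 1) * (s - 1).
  by rewrite -addn2 exprD; field; rewrite gt_eqF.
rewrite subrX1 mulrCA [leRHS]mulrC ler_pM2l ?subr_gt0//.
apply: (le_trans (ler_wpM2l _ sum_le)) => //.
rewrite mulrC ler_wpM2l ?mulr_ge0 ?exprn_ge0 ?(ltW s0)//.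
by rewrite -[2]/(1 + 1) lerD2r ltW.
Qed.

(* From 1 + u <= e^u in the moment generating function, letting s tend to 1. *)
Lemma gauss_second_moment : (\int[leb]_x (sqnorm x * pdf x)%:E <= n%:R%:E)%E.
Proof.
set M := (\int[leb]_x _)%E.
have msq : measurable_fun setT (fun x => (sqnorm x * pdf x)%:E).
  apply/measurable_EFinP; apply: measurable_funM.
    exact: measurable_sqnorm.
  exact: measurable_gauss_pdf.
have sq0 x : (0 <= (sqnorm x * pdf x)%:E)%E.
  by rewrite lee_fin mulr_ge0 ?sqnorm_ge0 ?gauss_pdf_ge0.
have bound s : 1 < s -> (M <= (n%:R * s ^+ n.+2)%:E)%E.
  move=> s1; have s0 : 0 < s by rewrite (lt_trans _ s1).
  have l0 : 0 < 1 - s ^- 2 by rewrite subr_gt0 invf_lt1 ?exprn_gt0// exprn_egt1.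
  have : (1 + ((1 - s ^- 2) / 2)%:E * M <= (s ^+ n)%:E)%E.
    rewrite -integral_gauss_pdf -(gauss_mgf s0) /M -ge0_integralZl//; last first.
      by rewrite lee_fin divr_ge0 ?ltW.
    rewrite -ge0_integralD//; last 4 first.
    - by move=> x _; rewrite lee_fin gauss_pdf_ge0.
    - by apply/measurable_EFinP; exact: measurable_gauss_pdf.
    - by move=> x _; rewrite mule_ge0// lee_fin divr_ge0 ?ltW.
    - exact: measurable_funeM.
    apply: ge0_le_integral => //.
    - move=> x _; rewrite adde_ge0 ?mule_ge0 ?sq0 ?lee_fin ?gauss_pdf_ge0//.
      by rewrite divr_ge0 ?ltW.
    - apply: emeasurable_funD; last exact: measurable_funeM.
      by apply/measurable_EFinP; exact: measurable_gauss_pdf.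
    - apply/measurable_EFinP; apply: measurable_funM; last exact: measurable_gauss_pdf.
      apply: measurableT_comp => //; apply: measurable_funM => //.
      exact: measurable_half_sqnorm.
    move=> x _; rewrite -EFinM -EFinD lee_fin.
    rewrite [leLHS](_ : _ = (1 + (1 - s ^- 2) * (sqnorm x / 2)) * pdf x);
      last by field; rewrite gt_eqF.
    by rewrite ler_wpM2r ?gauss_pdf_ge0// expR_ge1Dx.
  have : (0 <= M)%E by apply: integral_ge0.
  case: (M) => [m| |]//=.
    rewrite -EFinM -EFinD !lee_fin => m0 ms.
    rewrite -(ler_pM2r l0) (le_trans _ (sub1_expr_le s1))//.
    by move: (1 - s ^- 2) (s ^+ n) ms => l sn; nra.
  by rewrite gt0_muley ?lte_fin ?divr_gt0// addey.
(* For s = c^(1/(n+2)) the bound n s^(n+2) is exactly n + e. *)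
apply/lee_addgt0Pr => e e0; pose c := 1 + e / n%:R.
have n0 : 0 < n%:R :> R by rewrite ltr0n.
have c1 : 1 < c by rewrite ltrDl divr_gt0.
have c0 : 0 < c by rewrite (lt_trans _ c1).
apply: (le_trans (bound (c `^ (n.+2%:R^-1)) _)).
  have /gt0_ltr_powR : 0 < n.+2%:R^-1 :> R by rewrite invr_gt0 ltr0n.
  by move=> /(_ 1 c); rewrite powR1 !nnegrE ler01 (ltW c0) c1; exact.
rewrite -powR_mulrn ?powR_ge0// -powRrM mulVf ?pnatr_eq0// powRr1 ?(ltW c0)//.
by rewrite -EFinD lee_fin /c mulrDr mulr1 mulrCA divff ?gt_eqF// mulr1.
Qed.

(** Pointwise r <= r^2 / (2 c) + c / 2 for every c > 0. After integration c = sqrt n is the best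
    choice and makes the right side equal to c. *)
Lemma gauss_mean_le :
  (\int[leb]_x (Num.sqrt (sqnorm x) * pdf x)%:E <= (Num.sqrt n%:R)%:E)%E.
Proof.
have n0 : 0 < n%:R :> R by rewrite ltr0n.
have sn0 : 0 < Num.sqrt n%:R :> R by rewrite sqrtr_gt0.
set c := Num.sqrt n%:R in sn0 *.
have mpdf : measurable_fun setT (fun x => (pdf x)%:E).
  by apply/measurable_EFinP; exact: measurable_gauss_pdf.
have msq : measurable_fun setT (fun x => (sqnorm x * pdf x)%:E).
  apply/measurable_EFinP; apply: measurable_funM.
    exact: measurable_sqnorm.
  exact: measurable_gauss_pdf.
have pdf0 x : (0 <= (pdf x)%:E)%E by rewrite lee_fin gauss_pdf_ge0.
have sq0 x : (0 <= (sqnorm x * pdf x)%:E)%E.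
  by rewrite lee_fin mulr_ge0 ?sqnorm_ge0 ?gauss_pdf_ge0.
apply: (@le_trans _ _ (\int[leb]_x (((2 * c)^-1)%:E * (sqnorm x * pdf x)%:E +
    (c / 2)%:E * (pdf x)%:E))%E).
  apply: ge0_le_integral => //.
  - by move=> x _; rewrite lee_fin mulr_ge0 ?sqrtr_ge0 ?gauss_pdf_ge0.
  - apply/measurable_EFinP; apply: measurable_funM; last exact: measurable_gauss_pdf.
    exact: (measurableT_comp measurable_sqrt (@measurable_sqnorm _ _)).
  - by apply: emeasurable_funD; exact: measurable_funeM.
  move=> x _; rewrite -!EFinM -EFinD lee_fin (mulrA (2 * c)^-1) -mulrDl ler_wpM2r ?gauss_pdf_ge0//.
  rewrite -[X in _ * X](sqr_sqrtr (sqnorm_ge0 x)).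
  move: (Num.sqrt _) => r; rewrite -subr_ge0.
  rewrite (_ : _ - _ = (r - c) ^+ 2 / (2 * c)).
    by rewrite divr_ge0 ?sqr_ge0// mulr_ge0// ltW.
  by field; rewrite gt_eqF.
have c20 : 0 <= (2 * c)^-1 by rewrite invr_ge0 mulr_ge0// ltW.
have c2 : 0 <= c / 2 by rewrite divr_ge0// ltW.
rewrite ge0_integralD//; last 4 first.
- by move=> x _; rewrite mule_ge0.
- exact: measurable_funeM.
- by move=> x _; rewrite mule_ge0.
- exact: measurable_funeM.
rewrite !ge0_integralZl// integral_gauss_pdf mule1.
apply: (le_trans (leeD (lee_wpmul2l _ gauss_second_moment) (lexx _))).
  by rewrite lee_fin.
rewrite -EFinM -EFinD lee_fin -[n%:R](sqr_sqrtr (ltW n0)) -/c.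
rewrite le_eqVlt; apply/orP; left; apply/eqP.
by field; rewrite gt_eqF.
Qed.

(** Since 0 * +oo = 0, an infinite factor would make the product 0 or +oo. *)
Lemma mule_eq1_fin (x y : \bar R) : (0 <= x)%E -> (0 <= y)%E ->
  (x * y = 1)%E -> exists a b : R, [/\ x = a%:E, y = b%:E & a * b = 1].
Proof.
move: x y => [x| |] [y| |]//; rewrite ?lee_fin.
- by move=> _ _ [xy1]; exists x, y.
- rewrite le_eqVlt => /predU1P[<- _|x0 _]; last by rewrite gt0_muley.
  by rewrite mul0e => -[/esym/eqP]; rewrite oner_eq0.
- move=> _; rewrite le_eqVlt => /predU1P[<-|y0]; last by rewrite gt0_mulye.
  by rewrite mule0 => -[/esym/eqP]; rewrite oner_eq0.
Qed.

(** Radial integration gives K E_n = 1 for the mass and sqrt 2 K E_(n+1) for the mean, with the same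
    K. Hence the mean is sqrt 2 E_(n+1) / E_n, and K drops out. *)
Lemma gauss_mean : 0 < Gamma (n%:R / 2) :> R /\
  (\int[leb]_x (Num.sqrt (sqnorm x) * pdf x)%:E =
   (Num.sqrt 2 * (Gamma (n%:R / 2 + 2^-1) / Gamma (n%:R / 2)))%:E)%E.
Proof.
pose E k := (\int[mu]_t (expR (- t) * radial_weight k t)%:E)%E.
have E_ge0 k : (0 <= E k)%E.
  by apply: integral_ge0 => t _; rewrite lee_fin mulr_ge0 ?expR_ge0 ?radial_weight_ge0.
have GE k : (0 < k)%N -> Gamma (k%:R / 2) = fine (E k) :> R by exact: Gamma_radial.
have -> : n%:R / 2 + 2^-1 = n.+1%:R / 2 :> R by rewrite -(natr1 n) mulrDl mul1r.
rewrite !GE//.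
set K := ((normal_peak 1 ^+ n)%:E * @radial_const R n)%E.
have K_ge0 : (0 <= K)%E.
  rewrite mule_ge0 ?lee_fin ?exprn_ge0 ?normal_peak_ge0//.
  apply: integral_ge0 => x _; rewrite lee_fin; case: ifP => // _.
  by rewrite mulr_ge0 ?invr_ge0 ?exprn_ge0 ?sqrtr_ge0 ?half_sqnorm_ge0.
have KE : (K * E n = 1)%E.
  rewrite -integral_gauss_pdf; have := @integral_gauss_radial (fun=> 1).
  under eq_integral do rewrite mul1r.
  by move=> ->//; congr (_ * _)%E; apply: eq_integral => t _; rewrite mul1r.
have KE1 : (\int[leb]_x (Num.sqrt (sqnorm x) * pdf x)%:E =
    (Num.sqrt 2)%:E * (K * E n.+1))%E.
  transitivity (\int[leb]_x (Num.sqrt (2 * (sqnorm x / 2)) * pdf x)%:E)%E.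
    by apply: eq_integral => x _; rewrite [2 * _]mulrC divfK.
  (* The factor sqrt t of sqrt (2 t) raises the index of the radial weight from n to n + 1. *)
  rewrite (@integral_gauss_radial (fun t => Num.sqrt (2 * t))); last 2 first.
  - apply: (measurableT_comp measurable_sqrt); exact: measurable_funM.
  - by move=> t; rewrite sqrtr_ge0.
  rewrite [RHS]muleCA; congr (_ * _)%E; rewrite -ge0_integralZl ?lee_fin ?sqrtr_ge0//.
  - apply: eq_integral => t _; rewrite -EFinM sqrtrM// /radial_weight exprS.
    by congr EFin; ring.
  - apply/measurable_EFinP; apply: measurable_funM; last exact: measurable_radial_weight.
    exact: measurableT_comp.
  - by move=> t _; rewrite lee_fin mulr_ge0 ?expR_ge0 ?radial_weight_ge0.
(* The bound on the mean excludes [E n.+1] = +oo, for which [fine] would return 0. *)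
have := gauss_mean_le; rewrite KE1.
have [k [e [kE eE ke]]] := mule_eq1_fin K_ge0 (E_ge0 n) KE.
have ke0 : k * e != 0 by rewrite ke oner_neq0.
have k0 : 0 < k.
  by rewrite lt_neqAle eq_sym -lee_fin -kE K_ge0 andbT; apply: contraNneq ke0 => ->; rewrite mul0r.
have e0 : 0 < e.
  by rewrite lt_neqAle eq_sym -lee_fin -eE E_ge0 andbT; apply: contraNneq ke0 => ->; rewrite mulr0.
rewrite kE eE.
case: (E n.+1) (E_ge0 n.+1) => [e1| |]//; last first.
  by rewrite gt0_muley// gt0_muley// lte_fin sqrtr_gt0.
rewrite lee_fin -!EFinM /= => e10 _; split=> //.
by congr (_ * _)%:E; rewrite -[LHS](mulfK (lt0r_neq0 e0)); congr (_ / _); rewrite mulrAC ke mul1r.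
Qed.

End gaussian_moments.

(** With v = e^y this is y <= sinh y, and the derivative e^y + e^-y - 2 of the difference [f] is
    (e^y - 1)^2 / e^y. Chernoff's bound below reduces to exactly this inequality. *)
Lemma ln_le_half_subV (R : realType) (v : R) : 1 <= v -> ln v <= (v - v^-1) / 2.
Proof.
move=> v1; have v0 : 0 < v by rewrite (lt_le_trans _ v1).
pose f (y : R) := expR y - expR (- y) - 2 * y.
have df (x : R) : is_derive x (1 : R) f (expR x + expR (- x) - 2).
  rewrite /f; apply: is_derive_eq.
  by rewrite mulrN1 opprK /GRing.scale /= mulr1.
have f0 : f 0 = 0 by rewrite /f oppr0 subrr mulr0 subrr.
have : f 0 <= f (ln v).
  apply: (@ger0_derive1_ndecry _ f 0) => //.
  - move=> x _; rewrite derive1E derive_val.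
    have := expR_gt0 x; rewrite expRN; move: (expR x) => a a0.
    rewrite (_ : _ - _ = (a - 1) ^+ 2 / a); first by rewrite divr_ge0 ?sqr_ge0 ?ltW.
    by field; rewrite gt_eqF.
  - apply: derivable_within_continuous => x _; exact: ex_derive.
  - exact: ln_ge0.
rewrite f0 /f expRN lnK ?posrE//; lra.
Qed.

Section gaussian_tail.
Context {R : realType} {n : nat}.
Hypothesis n_gt0 : (0 < n)%N.

(* s is the optimal parameter in Chernoff's bound: 1 - s^-2 is twice the usual
   exponent of the moment generating function. *)
Lemma chernoff_exponent (x : R) : 0 <= x ->
  let s := Num.sqrt (1 + 2 * Num.sqrt (x / n%:R)) in
  [/\ 1 <= s &
    s ^+ n * expR (- ((1 - s ^- 2) *
      ((n%:R + 2 * Num.sqrt (n%:R * x) + 2 * x) / 2))) <= expR (- x)].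
Proof.
move=> x0; have n0 : 0 < n%:R :> R by rewrite ltr0n.
set sg := Num.sqrt (x / n%:R); have sg0 : 0 <= sg := sqrtr_ge0 _.
have xE : x = n%:R * sg ^+ 2.
  by rewrite sqr_sqrtr ?divr_ge0 ?(ltW n0)// mulrC divfK ?gt_eqF.
have -> : Num.sqrt (n%:R * x) = n%:R * sg.
  by rewrite {1}xE mulrA -expr2 -exprMn sqrtr_sqr ger0_norm// mulr_ge0// ltW.
(* In terms of v = s^2, the squared threshold n + 2 sqrt (n x) + 2 x is n (1 + v^2) / 2, since x = n
   sg^2. *)
rewrite /=; set v := 1 + 2 * sg; have v1 : 1 <= v by rewrite lerDl mulr_ge0.
have v0 : 0 < v by rewrite (lt_le_trans _ v1).
have s1 : 1 <= Num.sqrt v by rewrite -[leLHS]sqrtr1 ler_wsqrtr.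
have s0 : 0 < Num.sqrt v by rewrite (lt_le_trans _ s1).
split=> //; rewrite sqr_sqrtr ?(ltW v0)//.
have -> : Num.sqrt v ^+ n = expR (n%:R / 2 * ln v).
  rewrite -powR12_sqrt ?(ltW v0)// -powR_mulrn ?powR_ge0// -powRrM.
  by rewrite /powR gt_eqF// [2^-1 * _]mulrC.
rewrite -expRD ler_expR {}xE.
have := ln_le_half_subV v1.
have -> : sg = (v - 1) / 2 by rewrite /v; field.
move: (ln v) => l lv.
have : n%:R / 2 * l <= n%:R / 2 * ((v - v^-1) / 2).
  by rewrite ler_wpM2l// divr_ge0// ltW.
(* An exact identity: once ln v is replaced by its bound, the exponents on the two sides
   coincide. *)
have -> : n%:R / 2 * ((v - v^-1) / 2) =
    (1 - v^-1) * ((n%:R + 2 * (n%:R * ((v - 1) / 2)) +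
      2 * (n%:R * ((v - 1) / 2) ^+ 2)) / 2) - n%:R * ((v - 1) / 2) ^+ 2.
  by field; rewrite gt_eqF.
move: (_ * _) => A; lra.
Qed.

Lemma measurable_enorm_gt (c : R) :
  measurable [set x : 'cV[R]_n | c < enorm x].
Proof.
rewrite (_ : mkset _ = setT `&` (@enorm R n) @^-1` `]c, +oo[%classic).
  apply: (measurableT_comp measurable_sqrt (@measurable_sqnorm _ _)) => //.
by rewrite setTI; apply/seteqP; split=> y /=; rewrite in_itv/= andbT.
Qed.

Lemma gauss_tail (beta : R) : 0 < beta < 1 ->
  (gauss_measure [set x : 'cV[R]_n | (eta2 beta n < enorm x)%R] <= beta%:E)%E.
Proof.
move=> /andP[b0 b1].
have x0 : 0 <= ln (1 / beta) by rewrite ln_ge0// ler_pdivlMr// mul1r ltW.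
have bE : beta = expR (- ln (1 / beta)) by rewrite div1r lnV ?opprK ?lnK.
rewrite {2}bE /eta2; move: (ln (1 / beta)) x0 => x x0 {bE}.
set T := n%:R + _ + _.
have T0 : 0 <= T by rewrite !addr_ge0 ?mulr_ge0 ?sqrtr_ge0.
have [s1] := chernoff_exponent x0; rewrite -/T.
set s := Num.sqrt (1 + _) in s1 *.
have s0 : 0 < s by rewrite (lt_le_trans _ s1).
have l0 : 0 <= 1 - s ^- 2 by rewrite subr_ge0 invf_le1 ?exprn_gt0// exprn_ege1.
set A := [set x | _].
have mA : measurable A by exact: measurable_enorm_gt.
have mmgf : measurable_fun setT (fun y : 'cV[R]_n =>
    (expR ((1 - s ^- 2) * (sqnorm y / 2)) * gauss_pdf y)%:E).
  apply/measurable_EFinP; apply: measurable_funM; last exact: measurable_gauss_pdf.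
  apply: measurableT_comp => //; apply: measurable_funM => //.
  exact: measurable_half_sqnorm.
have mgf0 y : (0 <= (expR ((1 - s ^- 2) * (sqnorm y / 2)) * gauss_pdf y)%:E)%E.
  by rewrite lee_fin mulr_ge0 ?expR_ge0 ?gauss_pdf_ge0.
(* Markov's inequality: on [A] the squared norm exceeds T, so exp ((1 - s^-2) (|y|^2 - T) / 2) is at
   least 1 there. *)
move=> le_beta; apply: (@le_trans _ _ ((expR (- ((1 - s ^- 2) * (T / 2))))%:E *
  \int[lebesgue_cV n]_y (expR ((1 - s ^- 2) * (sqnorm y / 2)) * gauss_pdf y)%:E)%E);
  last by rewrite gauss_mgf// -EFinM lee_fin mulrC.
rewrite -ge0_integralZl ?lee_fin ?expR_ge0//.
apply: (@le_trans _ _ (\int[lebesgue_cV n]_(y in A) ((expR (- ((1 - s ^- 2) * (T / 2))))%:E *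
  (expR ((1 - s ^- 2) * (sqnorm y / 2)) * gauss_pdf y)%:E))%E); last first.
  apply: ge0_subset_integral => //; first exact: measurable_funeM.
  by move=> y _; rewrite mule_ge0// lee_fin expR_ge0.
apply: ge0_le_integral => //.
- by move=> y _; rewrite lee_fin gauss_pdf_ge0.
- by apply/measurable_EFinP/measurable_funTS; exact: measurable_gauss_pdf.
- by apply: measurable_funTS; exact: measurable_funeM.
move=> y Ay; rewrite -EFinM lee_fin mulrA -expRD ler_peMl ?gauss_pdf_ge0//.
rewrite -[leLHS]expR0 ler_expR addrC -mulrBr mulr_ge0// -mulrBl divr_ge0// subr_ge0.
rewrite -ler_sqrt ?sqnorm_ge0//; exact: ltW.
Qed.

End gaussian_tail.

Section std_gaussian_integral.
Context {R : realType} {disp : measure_display} {Omega : measurableType disp}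
  {P : probability Omega R} {n : nat} (Z : {RV P >-> 'cV[R]_n}).
Hypothesis gZ : std_gaussian Z.

(** The law of [Z] is known on sets. It is dominated by Lebesgue measure, integrals against it go
    through its Radon-Nikodym derivative, and this derivative is almost everywhere [gauss_pdf]
    because both have the same integral over every measurable set. *)
Lemma std_gaussian_integral (h : 'cV[R]_n -> \bar R) :
  measurable_fun setT h -> (forall x, 0 <= h x)%E ->
  (\int[P]_w h (Z w) = \int[lebesgue_cV n]_x (h x * (gauss_pdf x)%:E))%E.
Proof.
move=> mh h0; rewrite -[LHS](ge0_integral_distribution Z mh h0).
have mpdf : measurable_fun setT (fun x : 'cV[R]_n => (gauss_pdf x)%:E).
  by apply/measurable_EFinP; exact: measurable_gauss_pdf.
have dom : distribution P Z `<< lebesgue_cV n.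
  apply/null_content_dominatesP => A mA A0; rewrite std_gaussian_law//.
  by apply: null_set_integral => //; exact: measurable_funTS.
rewrite -(Radon_Nikodym_SigmaFinite.change_of_variables dom h0 measurableT mh).
apply: ae_eq_integral => //.
- apply: emeasurable_funM => //.
  exact: measurable_int (Radon_Nikodym_SigmaFinite.f_integrable dom).
- exact: emeasurable_funM.
apply: ae_eqe_mul2l; apply: integral_ae_eq => //.
- exact: Radon_Nikodym_SigmaFinite.f_integrable.
- move=> E _ mE; transitivity (distribution P Z E).
    exact/esym/Radon_Nikodym_SigmaFinite.f_integral.
  exact: std_gaussian_law.
Qed.

End std_gaussian_integral.

(** * Gram matrices *)

Section quadratic_expansion.
Context {R : realType} d (T : measurableType d)
  (mu : {measure set T -> \bar R}) (D : set T) (mD : measurable D).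
Local Notation intble g := (mu.-integrable D (EFin \o g)).

Lemma integrable_mul_sqr (f g : T -> R) :
  measurable_fun D f -> measurable_fun D g ->
  intble (fun t => f t ^+ 2) -> intble (fun t => g t ^+ 2) ->
  intble (fun t => f t * g t).
Proof.
move=> mf mg f2 g2; apply: (le_integrable mD _ _ (integrableD mD f2 g2)).
  by apply/measurable_EFinP; exact: measurable_funM.
move=> t _; rewrite /= lee_fin.
have [fg0 f20 g20] : [/\ 0 <= (`|f t| - `|g t|) ^+ 2, 0 <= f t ^+ 2 & 0 <= g t ^+ 2].
  by rewrite !sqr_ge0.
rewrite [leRHS]ger0_norm ?addr_ge0// normrM.
move: fg0; rewrite -(real_normK (num_real (f t))) -(real_normK (num_real (g t))).
have := normr_ge0 (f t); have := normr_ge0 (g t).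
by move: `|f t| `|g t| => x y; nra.
Qed.

Lemma integrable_rsum (I : Type) (s : seq I) (F : I -> T -> R) :
  (forall i, intble (F i)) -> intble (fun t => \sum_(i <- s) F i t).
Proof.
move=> iF; rewrite (_ : _ \o _ = fun t => (\sum_(i <- s) (F i t)%:E)%E).
  by apply: (@integrable_sum _ _ _ _ _ mD I s xpredT (fun i t => (F i t)%:E)) => i _; exact: iF.
by apply/funext => t; rewrite /= sumEFin.
Qed.

Lemma Rintegral_rsum (I : eqType) (s : seq I) (F : I -> T -> R) :
  (forall i, intble (F i)) ->
  \int[mu]_(t in D) (\sum_(i <- s) F i t) =
  \sum_(i <- s) \int[mu]_(t in D) F i t.
Proof.
move=> iF; rewrite /Rintegral.
under eq_integral do rewrite -sumEFin.
rewrite integral_sum//; apply: EFin_inj; rewrite -sumEFin fineK.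
  by apply: eq_bigr => i _; rewrite fineK//; exact: (integrable_fin_num mD (iF i)).
rewrite sum_fin_num; apply/allP => x /mapP[i _ ->].
exact: (integrable_fin_num mD (iF i)).
Qed.

Lemma integral_sqr_sum m (psi : 'I_m -> T -> R) (c : 'I_m -> R) :
  (forall j, measurable_fun D (psi j)) ->
  (forall j, intble (fun t => psi j t ^+ 2)) ->
  intble (fun t => (\sum_j c j * psi j t) ^+ 2) /\
  \int[mu]_(t in D) ((\sum_j c j * psi j t) ^+ 2) =
  \sum_j \sum_l c j * c l * \int[mu]_(t in D) (psi j t * psi l t).
Proof.
move=> mpsi psi2.
have ijl j l : intble (fun t => psi j t * psi l t) by exact: integrable_mul_sqr.
have icjl j l : intble (fun t => c j * c l * (psi j t * psi l t)).
  rewrite (_ : _ \o _ = fun t => ((c j * c l)%:E * (psi j t * psi l t)%:E)%E)//.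
  exact: (integrableZl mD (c j * c l) (ijl j l)).
have -> : (fun t => (\sum_j c j * psi j t) ^+ 2) =
    fun t => \sum_j \sum_l c j * c l * (psi j t * psi l t).
  apply/funext => t; rewrite expr2 mulr_suml; apply: eq_bigr => j _.
  by rewrite mulr_sumr; apply: eq_bigr => l _; rewrite mulrACA.
split; first by do 2 apply: integrable_rsum => ?.
rewrite Rintegral_rsum => [|j]; last by apply: integrable_rsum.
apply: eq_bigr => j _; rewrite Rintegral_rsum//; apply: eq_bigr => l _.
by rewrite RintegralZl.
Qed.

End quadratic_expansion.

Lemma qformE (R : realType) n (G : 'M[R]_n) v :
  qform G v = \sum_j \sum_l v j 0 * v l 0 * G j l.
Proof.
rewrite /qform mxE exchange_big; apply: eq_bigr => l _.
by rewrite mxE mulr_suml; apply: eq_bigr => j _; rewrite mxE mulrAC.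
Qed.

Section gram.
Context {R : realType} {d : nat} (I : set 'cV[R]_d) (mI : measurable I).
Local Notation leb := (lebesgue_cV d).

Lemma sq_integrable_sqr (g : 'cV[R]_d -> R) : sq_integrable I g ->
  leb.-integrable I (EFin \o (fun t => g t ^+ 2)).
Proof.
move=> [mg g2]; apply/integrableP; split.
  by apply/measurable_EFinP; exact: measurable_funX.
by under eq_integral do rewrite /= ger0_norm ?sqr_ge0//.
Qed.

Lemma sq_integrable_coord n (g : 'cV[R]_d -> 'cV[R]_n) r :
  sq_integrable_vec I g -> sq_integrable I (fun t => g t r 0).
Proof.
move=> [mg g2]; have mc i : measurable_fun I (fun t => g t i 0).
  exact: (measurableT_comp (measurable_coord i)).
split=> //; apply: le_lt_trans g2; apply: ge0_le_integral => //.
- by move=> t _; rewrite lee_fin sqr_ge0.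
- by apply/measurable_EFinP; exact: measurable_funX.
- apply/measurable_EFinP; apply: measurable_funX.
  apply: (measurableT_comp measurable_sqrt).
  exact: (measurableT_comp (@measurable_sqnorm _ _)).
move=> t _; rewrite lee_fin sqr_sqrtr ?sqnorm_ge0//.
by rewrite (bigD1 r)//= lerDl sumr_ge0// => i _; rewrite sqr_ge0.
Qed.

(** Indexing both [psi] and [c] by the coordinate r covers the two settings at once: real
    coefficients do not vary with r, and real-valued basis functions do not either. *)
Lemma integral_sqnorm n m (F : 'cV[R]_d -> 'cV[R]_n)
    (psi : 'I_n -> 'I_m -> 'cV[R]_d -> R) (c : 'I_n -> 'I_m -> R) :
  (forall r j, sq_integrable I (psi r j)) ->
  (forall t r, F t r 0 = \sum_j c r j * psi r j t) ->
  leb.-integrable I (fun t => (enorm (F t) ^+ 2)%:E) /\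
  \int[leb]_(t in I) (enorm (F t) ^+ 2) =
  \sum_r \sum_j \sum_l c r j * c r l * \int[leb]_(t in I) (psi r j t * psi r l t).
Proof.
move=> psi2 FE.
have E r := @integral_sqr_sum R _ _ leb I mI m (psi r) (c r)
  (fun j => (psi2 r j).1) (fun j => sq_integrable_sqr (psi2 r j)).
have -> : (fun t => enorm (F t) ^+ 2) =
    fun t => \sum_r (\sum_j c r j * psi r j t) ^+ 2.
  apply/funext => t; rewrite enormE sqr_sqrtr ?sqnorm_ge0//.
  by apply: eq_bigr => r _; rewrite FE.
have -> : (fun t => (enorm (F t) ^+ 2)%:E) =
    EFin \o fun t => \sum_r (\sum_j c r j * psi r j t) ^+ 2.
  apply/funext => t; rewrite enormE sqr_sqrtr ?sqnorm_ge0//=.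
  by congr EFin; apply: eq_bigr => r _; rewrite FE.
split; first by apply: integrable_rsum => // r; exact: (E r).1.
rewrite Rintegral_rsum//; last by move=> r; exact: (E r).1.
by apply: eq_bigr => r _; rewrite (E r).2.
Qed.

Lemma integral_enorm_eq0 n (F : 'cV[R]_d -> 'cV[R]_n) :
  leb.-integrable I (fun t => (enorm (F t) ^+ 2)%:E) ->
  \int[leb]_(t in I) (enorm (F t) ^+ 2) = 0 ->
  {ae leb, forall t, I t -> F t = 0}.
Proof.
move=> iF F0; have : (\int[leb]_(t in I) `|(enorm (F t) ^+ 2)%:E| = 0)%E.
  under eq_integral do rewrite gee0_abs ?lee_fin ?sqr_ge0//.
  by rewrite -[LHS]fineK ?integrable_fin_num//; congr EFin.
move/(ae_eq_integral_abs _ mI (measurable_int _ iF)).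
apply: filterS => t F0t It; have [] := F0t It.
rewrite enormE sqr_sqrtr ?sqnorm_ge0// => /eqP.
rewrite psumr_eq0 => [/allP s0|i _]; last exact: sqr_ge0.
apply/colP => i; rewrite [RHS]mxE; apply/eqP; rewrite -sqrf_eq0.
by apply: s0; exact: mem_index_enum.
Qed.

Lemma dist2_sqr n (f g : 'cV[R]_d -> 'cV[R]_n) :
  dist2 I f g ^+ 2 = \int[leb]_(t in I) (enorm (f t - g t) ^+ 2).
Proof. by rewrite sqr_sqrtr// Rintegral_ge0// => t _; exact: sqr_ge0. Qed.

(* Non-degeneracy of the Gram matrix is exactly linear independence, both being
   taken modulo almost everywhere equality. *)
Lemma gram_spd n N (f : 'cV[R]_N -> 'cV[R]_d -> 'cV[R]_n) (G : 'M[R]_N) :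
  G^T = G ->
  (forall v, leb.-integrable I (fun t => (enorm (f v t) ^+ 2)%:E)) ->
  (forall v, \int[leb]_(t in I) (enorm (f v t) ^+ 2) = qform G v) ->
  (forall v, {ae leb, forall t, I t -> f v t = 0} -> v = 0) ->
  spd G.
Proof.
move=> Gs iF FG F0; split=> // v v0; rewrite -/(qform G v) -FG.
rewrite lt_neqAle Rintegral_ge0 ?andbT => [|t _]; last exact: sqr_ge0.
rewrite eq_sym; apply: contraNneq v0 => E; apply/eqP/F0.
exact: integral_enorm_eq0.
Qed.

Lemma real_comb_gram n m (phi : 'I_m -> 'cV[R]_d -> 'cV[R]_n) :
  (forall j, sq_integrable_vec I (phi j)) -> lin_indep I phi ->
  spd (real_gram I phi) /\
  forall a b, dist2 I (real_comb phi a) (real_comb phi b) ^+ 2 =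
    qform (real_gram I phi) (a - b).
Proof.
move=> phi2 phi_indep.
have [iF FG] : (forall v, leb.-integrable I (fun t => (enorm (real_comb phi v t) ^+ 2)%:E)) /\
    forall v, \int[leb]_(t in I) (enorm (real_comb phi v t) ^+ 2) =
      qform (real_gram I phi) v.
  have E v := @integral_sqnorm n m (real_comb phi v) (fun r j t => phi j t r 0)
    (fun r j => v j 0) (fun r j => sq_integrable_coord r (phi2 j)).
  have FE v t r : real_comb phi v t r 0 = \sum_j v j 0 * phi j t r 0.
    by rewrite /real_comb summxE; apply: eq_bigr => j _; rewrite mxE.
  split=> v; first exact: (E v (FE v)).1.
  rewrite (E v (FE v)).2 qformE exchange_big; apply: eq_bigr => j _.
  rewrite exchange_big; apply: eq_bigr => l _.
  by rewrite mxE mulr_sumr.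
split=> [|a b].
  apply: (gram_spd (f := real_comb phi)) => //.
    apply/matrixP => j l; rewrite !mxE; apply: eq_bigr => r _.
    by apply: eq_Rintegral => t _; rewrite mulrC.
  by move=> v /phi_indep v0; apply/colP => j; rewrite v0 mxE.
rewrite dist2_sqr -FG; apply: eq_Rintegral => t _; congr (enorm _ ^+ 2).
rewrite /real_comb -sumrB; apply: eq_bigr => j _.
by rewrite -scalerBl !mxE.
Qed.

(** Coordinate r of the function is the scalar combination of the basis with coefficients from block
    r. Hence the form splits into n copies of that of [vec_gram0], and linear independence applies
    to each block separately. *)
Lemma vec_comb_gram n m (phi : 'I_m -> 'cV[R]_d -> R) :
  (forall j, sq_integrable I (phi j)) -> @lin_indep R d I R^o m phi ->
  spd (vec_gram I n phi) /\
  forall a b, dist2 I (vec_comb (n := n) phi a) (vec_comb phi b) ^+ 2 =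
    qform (vec_gram I n phi) (a - b).
Proof.
move=> phi2 phi_indep.
have FE v t r : vec_comb (n := n) phi v t r 0 = \sum_j submxcol v r j 0 * phi j t.
  by rewrite /vec_comb summxE; apply: eq_bigr => j _; rewrite mxE mxE mulrC.
have qE (v : 'cV[R]_(\sum_(r < n) m)) : qform (vec_gram I n phi) v =
    \sum_r qform (vec_gram0 I phi) (submxcol v r).
  rewrite /qform -[v in LHS]submxcolK tr_mxcol mul_mxrow_mxdiag mul_mxrow_mxcol.
  by rewrite summxE.
have [iF FG] :
    (forall v, leb.-integrable I
      (fun t => (enorm (vec_comb (n := n) phi v t) ^+ 2)%:E)) /\
    forall v, \int[leb]_(t in I) (enorm (vec_comb (n := n) phi v t) ^+ 2) =
      qform (vec_gram I n phi) v.
  have E v := @integral_sqnorm n m (vec_comb phi v) (fun r j t => phi j t)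
    (fun r j => submxcol v r j 0) (fun r j => phi2 j) (FE v).
  split=> v; first exact: (E v).1.
  rewrite (E v).2 qE; apply: eq_bigr => r _; rewrite qformE.
  by apply: eq_bigr => j _; apply: eq_bigr => l _; rewrite [vec_gram0 _ _ _ _]mxE.
split=> [|a b].
  apply: (gram_spd (f := vec_comb (n := n) phi)) => //.
    rewrite tr_mxdiag; congr mxdiag; apply/funext => r.
    apply/matrixP => j l; rewrite !mxE.
    by apply: eq_Rintegral => t _; rewrite mulrC.
  move=> v v0; rewrite -[v]submxcolK -[RHS]submxcolK; congr mxcol; apply/funext => r.
  apply/colP => j; rewrite [RHS]mxE [RHS]mxE.
  apply: (phi_indep (fun j => submxcol v r j 0)).
  apply: filterS v0 => t v0 It; have /colP/(_ r) := v0 It.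
  by rewrite FE mxE.
rewrite dist2_sqr -FG; apply: eq_Rintegral => t _; congr (enorm _ ^+ 2).
rewrite /vec_comb -sumrB; apply: eq_bigr => j _.
by rewrite -scalerBr; congr (_ *: _); apply/colP => r; rewrite !mxE.
Qed.

(** The common interface of the two settings: from here on a positive definite [G] stands for the
    basis. *)
Lemma function_space_gram n m na N (f : 'cV[R]_N -> 'cV[R]_d -> 'cV[R]_n)
    (Sigma : 'M[R]_N) : function_space I m na f Sigma ->
  N = (na * m)%N /\ exists G, [/\ spd G, Sigma = invmx G &
    forall a b, dist2 I (f a) (f b) ^+ 2 = qform G (a - b)].
Proof.
case: na N f Sigma / => [phi phi2 phi_indep|phi phi2 phi_indep].
  have [G0 dE] := real_comb_gram phi2 phi_indep.
  by split; [rewrite mul1n | exists (real_gram I phi)].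
have [G0 dE] := vec_comb_gram n phi2 phi_indep.
by split; [rewrite sum_nat_const card_ord | exists (vec_gram I n phi)].
Qed.

End gram.

(** * Exact error of the mechanism, and the final assembly *)

Section mechanism_error.
Context {R : realType} {disp : measure_display} {Omega : measurableType disp}
  {P : probability Omega R} {n : nat} (Z : {RV P >-> 'cV[R]_n}).
Variables (rho : R) (G : 'M[R]_n).
Hypotheses (rho_gt0 : 0 < rho) (spdG : spd G).

(** The root [S] whitens [G]: from S S = G^-1 follows S G S = 1, so the form of the noise is a
    multiple of |Z|^2. *)
Lemma qform_gauss_mech a w :
  qform G (gauss_mech rho (invmx G) Z a w - a) = sqnorm (Z w) / (2 * rho).
Proof.
have [spdS SS] := spd_sqrtP (spd_invmx spdG).
set S := spd_sqrt (invmx G) in spdS SS.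
have Su := spd_unitmx spdS; have Gu := spd_unitmx spdG.
have SGS : S *m G *m S = 1%:M.
  by rewrite -[LHS](mulmxK Su) -(mulmxA (S *m G)) SS mulmxK// mulmxV.
rewrite /gauss_mech addrC addKr -/S; set r := _^-1.
have rE : r ^+ 2 = (2 * rho)^-1 by rewrite exprVn sqr_sqrtr// mulr_ge0// ltW.
rewrite mulrC -rE sqnormE /qform.
have -> : (r *: (S *m Z w))^T = r *: ((Z w)^T *m S).
  by rewrite linearZ /= trmx_mul spdS.1.
rewrite -!(scalemxAl, scalemxAr) scalerA -expr2 mxE; congr (_ * _).
by rewrite !mulmxA -(mulmxA _ S) -(mulmxA _ (S *m G)) SGS mulmx1.
Qed.

End mechanism_error.

Theorem corollary3p2 (R : realType) (d n m : nat)
    (d_gt0 : (0 < d)%N) (n_gt0 : (0 < n)%N) (m_gt0 : (0 < m)%N)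
    (J : 'I_d -> set R) (mJ : forall i, measurable (J i))
    (rho : R) (rho_gt0 : 0 < rho)
    (na N : nat) (f : 'cV[R]_N -> 'cV[R]_d -> 'cV[R]_n) (Sigma : 'M[R]_N)
    (fU : function_space (box J) m na f Sigma)
    (disp : measure_display) (Omega : measurableType disp)
    (P : probability Omega R) (Z : {RV P >-> 'cV[R]_N})
    (gZ : std_gaussian Z) :
  let I := box J in
  let dimU := (na * m)%N in
  let M := gauss_mech rho Sigma Z in
  CGP (fun a a' => dist2 I (f a) (f a')) rho (fun a => distribution P (M a)) /\
  forall a : 'cV[R]_N,
    [/\ 'E_P[fun w => dist2 I (f (M a w)) (f a)]%E =
          (Num.sqrt 2 * (Gamma (dimU%:R / 2 + 2^-1) /
             (Gamma (dimU%:R / 2) * Num.sqrt (2 * rho))))%:E,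
        Num.sqrt 2 * (Gamma (dimU%:R / 2 + 2^-1) /
             (Gamma (dimU%:R / 2) * Num.sqrt (2 * rho))) <=
          Num.sqrt dimU%:R / Num.sqrt (2 * rho) &
        forall beta : R, 0 < beta < 1 ->
          ((1 - beta)%:E <=
           P [set w | (dist2 I (f (M a w)) (f a) <=
                       eta2 beta dimU / Num.sqrt (2 * rho))%R])%E].
Proof.
have dimU_gt0 : (0 < na * m)%N.
  by case: fU => *; rewrite ?mul1n// muln_gt0 n_gt0.
move=> I dimU M.
have mI : measurable I by exact: measurable_box.
have [NE [G [spdG SigmaE distE]]] := function_space_gram mI fU.
rewrite -/dimU in dimU_gt0 NE; move: dimU NE dimU_gt0 => k kE k_gt0; subst k.
have spdS : spd Sigma by rewrite SigmaE; exact: spd_invmx.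
have GE : invmx Sigma = G by rewrite SigmaE invmxK.
pose c := Num.sqrt (2 * rho).
have c0 : 0 < c by rewrite sqrtr_gt0 mulr_gt0.
have errE a w : dist2 I (f (M a w)) (f a) = Num.sqrt (sqnorm (Z w)) / c.
  rewrite -[LHS]ger0_norm ?sqrtr_ge0// -sqrtr_sqr distE /M SigmaE.
  by rewrite qform_gauss_mech// sqrtrM ?sqnorm_ge0// sqrtrV// mulr_ge0// ltW.
have [Gamma0 meanE] := gauss_mean (R := R) k_gt0.
have meanle := gauss_mean_le (R := R) k_gt0.
split.
  have [d0 dP] := gauss_mech_density gZ rho_gt0 spdS.
  apply: (@CGP_gaussian _ _ _ G rho d0) => //; first exact: spdG.1.
  by move=> a; rewrite -GE.
move=> a; split.
- rewrite unlock.
  under eq_integral do rewrite errE mulrC.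
  rewrite (std_gaussian_integral gZ (h := fun x => (c^-1 * Num.sqrt (sqnorm x))%:E)); last 2 first.
  - apply/measurable_EFinP; apply: measurable_funM => //.
    exact: (measurableT_comp measurable_sqrt (@measurable_sqnorm _ _)).
  - by move=> x; rewrite lee_fin mulr_ge0 ?invr_ge0 ?sqrtr_ge0.
  transitivity (c^-1%:E *
      \int[lebesgue_cV N]_x (Num.sqrt (sqnorm x) * gauss_pdf x)%:E)%E.
    rewrite -ge0_integralZl ?lee_fin ?invr_ge0 ?sqrtr_ge0//.
    - by apply: eq_integral => x _; rewrite -!EFinM -mulrA.
    - apply/measurable_EFinP; apply: measurable_funM; last exact: measurable_gauss_pdf.
      exact: (measurableT_comp measurable_sqrt (@measurable_sqnorm _ _)).
    - by move=> x _; rewrite lee_fin mulr_ge0 ?sqrtr_ge0 ?gauss_pdf_ge0.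
  by rewrite meanE -EFinM; congr EFin; rewrite -/c; field; rewrite !gt_eqF.
(* Both sides carry the factor 1 / c; what remains is the mean bound, with the mean written in
   closed form. *)
- rewrite -/c invfM mulrA mulrA ler_pM2r ?invr_gt0// -lee_fin -mulrA.
  by rewrite -meanE.
move=> beta b01.
set E := [set w | _].
(* By the error identity the good event is the complement of the tail event for |Z|, whose
   probability is at most beta. *)
have EE : E = ~` (Z @^-1` [set x | eta2 beta N < enorm x]).
  apply/seteqP; split => w /=; rewrite /E /= errE ler_pM2r ?invr_gt0// leNgt.
    by move/negP.
  by move=> ?; apply/negP.
have mZ : measurable (Z @^-1` [set x | eta2 beta N < enorm x]).
  have mZf : measurable_fun setT Z by exact: measurable_funPT.
  rewrite -[X in measurable X]setTI; apply: mZf => //.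
  exact: measurable_enorm_gt.
rewrite EE probability_setC// EFinB leeB//.
have := gauss_tail (R := R) k_gt0 b01.
rewrite -(std_gaussian_law gZ)//.
exact: measurable_enorm_gt.
Qed.
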